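(* There is a universal constant $c>0$ such that the following holds for every integer $n\ge 2$, all real $r,R>0$, every unconditional convex body $Q\subset\mathbb{R}^n$, all points $x_0,y_0\in\mathbb{R}^n$, and every convex body $K\subset\mathbb{R}^n$ satisfying $$x_0+rQ\subset K\subset y_0+RQ.$$ For every Borel set $S\subset K$ with $0<\operatorname{vol}(S)\le \operatorname{vol}(K)/2$, writing $s=\operatorname{vol}(S)/\operatorname{vol}(K)$, $$\frac{\operatorname{vol}(\partial_0^K S)}{\operatorname{vol}(S)}\ \ge\ \frac{cr}{nR}\min\left\{1,\frac{\log(e/s)}{n}\right\} =\begin{cases}\dfrac{cr}{n^2R}\log\dfrac es, & s\ge e^{1-n},\\[2mm] \dfrac{cr}{nR}, & s\le e^{1-n}.\end{cases}$$ Consequently, $$\frac{cr}{n^2R}\le \xi_0(K)\le \psi_0(K).$$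
   Context: A convex body is a compact convex set with nonempty interior; $\operatorname{vol}$ is Lebesgue measure. A convex body $Q\subset\mathbb{R}^n$ is unconditional if $(q_1,\dots,q_n)\in Q$ implies $(\varepsilon_1q_1,\dots,\varepsilon_nq_n)\in Q$ for all signs $\varepsilon_i\in\{-1,1\}$. For a Borel set $S\subset K$, the $\ell_0$ boundary $\partial_0^K S$ is the set of $y\in K\setminus S$ for which there is $x\in S$ such that $x$ and $y$ differ in at most one coordinate (it is analytic, hence Lebesgue measurable). Two sets $A,B\subset\mathbb{R}^n$ are axis-disjoint if any $x\in A$ and $y\in B$ differ in at least two coordinates. The one-set coefficient is $$\xi_0(K)=\inf\left\{\frac{\operatorname{vol}(\partial_0^K S)}{\operatorname{vol}(S)}: S\subset K\text{ Borel},\ 0<\operatorname{vol}(S)\le \tfrac12\operatorname{vol}(K)\right\},$$ and the separator coefficient is $$\psi_0(K)=\inf\left\{\frac{\operatorname{vol}(K\setminus(A\cup B))}{\min\{\operatorname{vol}(A),\operatorname{vol}(B)\}}: A,B\subset K\text{ Borel, axis-disjoint, } \min\{\operatorname{vol}(A),\operatorname{vol}(B)\}>0\right\}.$$ Both are invariant under translations and scalar dilations. *)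

(* Defs.v *)
From HB Require Import structures.
From mathcomp Require Import all_boot all_order all_algebra.
From mathcomp Require Import all_classical all_reals all_analysis.

Set Implicit Arguments.
Unset Strict Implicit.
Unset Printing Implicit Defensive.

Import Order.TTheory GRing.Theory Num.Theory.
Import numFieldNormedType.Exports.

Local Open Scope classical_set_scope.
Local Open Scope ring_scope.

Section LebesgueCons.
Context (R : realType) (n : nat).
Local Notation mR := (measurableTypeR R).
Variable mu : {sigma_finite_measure set (n.-tuple mR) -> \bar R}.

Definition tuple_cons (p : mR * n.-tuple mR) : n.+1.-tuple mR :=
  [the n.+1.-tuple mR of p.1 :: p.2].

Lemma measurable_tuple_cons : measurable_fun [set: mR * n.-tuple mR] tuple_cons.
Proof. exact: (measurable_cons measurable_fst measurable_snd). Qed.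

Definition lebesgue_cons : set (n.+1.-tuple mR) -> \bar R :=
  pushforward (@lebesgue_measure R \x mu)%E tuple_cons.

Let nu : {measure set (n.+1.-tuple mR) -> \bar R} :=
  measure_function_pushforward__canonical__measure_function_Measure
    (@lebesgue_measure R \x mu)%E measurable_tuple_cons.

Let lebesgue_cons0 : lebesgue_cons set0 = 0%E.
Proof. exact: (measure0 nu). Qed.

Let lebesgue_cons_ge0 A : (0 <= lebesgue_cons A)%E.
Proof. exact: (measure_ge0 nu). Qed.

Let lebesgue_cons_sigma_additive : semi_sigma_additive lebesgue_cons.
Proof. exact: (@measure_semi_sigma_additive _ _ _ nu). Qed.

HB.instance Definition _ := isMeasure.Build _ _ _ lebesgue_cons
  lebesgue_cons0 lebesgue_cons_ge0 lebesgue_cons_sigma_additive.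

Let lebesgue_cons_sigma_finite : sigma_finite setT lebesgue_cons.
Proof.
have /sigma_finiteP[F [TF ndF Foo]] := sigma_finiteT (@lebesgue_measure R).
have /sigma_finiteP[G [TG ndG Goo]] := sigma_finiteT mu.
pose uncons (t : n.+1.-tuple mR) : mR * n.-tuple mR :=
  (thead t, [tuple of behead t]).
have muncons : measurable_fun setT uncons.
  apply/measurable_fun_pairP; split; last exact: measurable_behead.
  exact: (measurable_tnth ord0).
have unconsK p : uncons (tuple_cons p) = p.
  by case: p => x t; congr pair; apply/val_inj.
exists (fun k => uncons @^-1` (F k `*` G k)).
  rewrite -preimage_bigcup (_ : \bigcup_k _ = setT) ?preimage_setT//.
  apply/seteqP; split=> // -[x t] _.
  have [i _ Fx] : (\bigcup_i F i) x by rewrite -TF.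
  have [j _ Gt] : (\bigcup_j G j) t by rewrite -TG.
  exists (maxn i j) => //; split.
  - by move: x Fx; exact/subsetPset/ndF/leq_maxl.
  - by move: t Gt; exact/subsetPset/ndG/leq_maxr.
move=> k; have [mF Fk] := Foo k; have [mG Gk] := Goo k; split.
  by rewrite -[X in measurable X]setTI; apply: muncons => //; exact: measurableX.
rewrite /lebesgue_cons /pushforward -comp_preimage.
rewrite (_ : uncons \o _ = id); last exact/funext.
by rewrite preimage_id product_measure1E// lte_mul_pinfty// ge0_fin_numE.
Qed.

HB.instance Definition _ := Measure_isSigmaFinite.Build _ _ _
  lebesgue_cons lebesgue_cons_sigma_finite.

End LebesgueCons.

(* The n-fold product of the Lebesgue measure of the line. *)
Fixpoint lebesgue_tuple (R : realType) (n : nat) :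
    {sigma_finite_measure set (n.-tuple (measurableTypeR R)) -> \bar R} :=
  match n with
  | 0%N => \d_([tuple] : 0.-tuple (measurableTypeR R))
  | m.+1 => lebesgue_cons (lebesgue_tuple R m)
  end.

Section LZeroIsoperimetry.
Context (R : realType) (n : nat).
Implicit Types (x y : 'rV[R]_n) (A B S K Q : set 'rV[R]_n).

Definition borel A : Prop := <<s [set U : set 'rV[R]_n | open U] >> A.

(* The outer measure [mu^*] is used because the l_0 boundary of a Borel set
   need not be Borel; on Lebesgue measurable sets it is the (completed) Lebesgue
   measure. Real-valued: [vol A] is only meaningful when A has finite outer
   measure, e.g., when A is bounded. *)
Definition vol A : R :=
  fine ((lebesgue_tuple R n)^*%mu [set t | A (\row_i tnth t i)]).

Definition convex_body K : Prop :=
  [/\ compact K, convex_set K & K° !=set0].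

Definition unconditional Q : Prop :=
  forall q (eps : 'I_n -> R), (forall i, eps i = 1 \/ eps i = -1) ->
    Q q -> Q (\row_i (eps i * q 0 i)).

Definition ncoord_diff x y : nat := #|[pred i | x 0 i != y 0 i]|.

Definition boundary0 K S : set 'rV[R]_n :=
  [set y | (K `\` S) y /\ exists2 x, S x & (ncoord_diff x y <= 1)%N].

Definition axis_disjoint A B : Prop :=
  forall x y, A x -> B y -> (2 <= ncoord_diff x y)%N.

Definition xi0 K : \bar R :=
  ereal_inf [set (vol (boundary0 K S) / vol S)%:E | S in
    [set S | [/\ S `<=` K, borel S & 0 < vol S <= vol K / 2]]].

Definition psi0 K : \bar R :=
  ereal_inf [set (vol (K `\` (AB.1 `|` AB.2)) /
                  Num.min (vol AB.1) (vol AB.2))%:E | AB in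
    [set AB : set 'rV[R]_n * set 'rV[R]_n |
      [/\ AB.1 `<=` K, AB.2 `<=` K, borel AB.1 & borel AB.2] /\
      axis_disjoint AB.1 AB.2 /\ 0 < Num.min (vol AB.1) (vol AB.2)]].

End LZeroIsoperimetry.

(* Main.v *)
(* Call x in K deep if x lies in (1 - d) K + d x0 with d = const / n. From a point
   x of depth d one may move by d r Q and stay in K, and since Q is unconditional
   the coordinates of such a move may be updated one at a time; if the move leaves
   S, one of the n intermediate points lies in the l_0 boundary of S.

   If a fixed proportion of S is deep, couple the uniform law on the deep part of S
   with the uniform law on the deep part of K by a monotone coupling (between finite
   unions of boxes approximating both sets) and follow the segments between coupled
   points in steps of relative size d r / (2 Rad). The density of the point at time
   tau is at most |S|^-(1 - tau) |K|^-tau, so by time tau ~ 1 / log (e / s) a constant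
   proportion of the paths has left S, while no step uses a piece of the boundary
   with too large a density. There are about tau n Rad / r steps of n moves each.

   Otherwise S is concentrated near the boundary of K. There the dilations towards
   x0 that move a point of depth d by a multiple of d r / Rad expand volume, as depth
   grows geometrically along them; this expansion again forces S to be left. *)

(* The [l_0] boundary need not be Borel, so every estimate is proved for an arbitrary measurable [M]
   containing it; [le_vol_outer_hull] then passes to the infimum over [M]. The coupling has to
   control more than the points of the segments: while a step is carried out one coordinate at a
   time, the coordinates are at different times. Pieces ordered the same way along one coordinate,
   in source and target, stay disjoint whatever time each coordinate has reached. The mixed times
   cost only a factor 2 in density, because a step has relative size [h] of order [1 / n] and
   [(1 - 2 h) ^ n >= 1 / 2]. Depth of order [1 / n] is the natural scale since depth [d] keeps the
   fraction [(1 - d) ^ n] of [K]. Nearer to the boundary of [K] no step length is uniformly safe,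
   and dilations replace segments because their displacement can be made proportional to the depth.
   The gain there comes from an asymmetry: a dilation adapted to depth [d] advances the shallow edge
   of a shell by two levels and the deep edge by at most one. This case gives order [r / (n Rad)]
   outright, so the logarithm comes from the coupling alone. *)
Require Import Defs.
From HB Require Import structures.
From mathcomp Require Import all_boot all_order all_algebra.
From mathcomp Require Import all_classical all_reals all_analysis.
From mathcomp Require Import measurable_realfun measure_extension ring lra zify.

Set Implicit Arguments.
Unset Strict Implicit.
Unset Printing Implicit Defensive.

Import Order.TTheory GRing.Theory Num.Theory.
Import numFieldNormedType.Exports.

Local Open Scope classical_set_scope.
Local Open Scope ring_scope.

(** * Scaling of Lebesgue measure under coordinatewise affine maps *)

Section affine_measure.
Context (R : realType).
Local Notation mR := (measurableTypeR R).

Lemma measurable_affine (a b : R) :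
  measurable_fun [set: mR] ((fun x => a + b * x) : mR -> mR).
Proof. by apply: measurable_funD => //; exact: measurable_funM. Qed.

(** Both sides are measures in [A] that agree on half-open intervals, which determine Lebesgue
    measure. *)
Lemma lebesgue_measure_affine (a b : R) (A : set mR) : 0 < b -> measurable A ->
  (b%:E * lebesgue_measure ([set x | A (a + b * x)%R] : set mR) =
   lebesgue_measure A)%E.
Proof.
move=> b0 mA; have b0' : 0 <= b := ltW b0.
pose nu : {measure set mR -> \bar R} :=
  measure_function_pushforward__canonical__measure_function_Measure
    (@lebesgue_measure R) (measurable_affine a b).
rewrite [LHS](_ : _ = mscale (NngNum b0') nu A)//; apply/esym.
apply: lebesgue_measure_unique => // _ [[c d]] _ <- /=.
rewrite /mscale/= /pushforward.
rewrite (_ : _ @^-1` _ = `](c - a) / b, (d - a) / b]%classic); last first.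
  apply/seteqP; split => x /=; rewrite !in_itv/= ltr_pdivrMr// ler_pdivlMr//;
    by rewrite ltrBlDl lerBrDl [x * b]mulrC.
rewrite !lebesgue_measure_itv/= !lte_fin.
rewrite ltr_pM2r ?invr_gt0// ltrD2r; case: ifPn => _; last by rewrite mule0.
by rewrite -!EFinB -EFinM; congr EFin; field; rewrite gt_eqF.
Qed.

(** Each coordinate has its own factor: such maps parametrise boxes, and also contract only those
    coordinates that have already been updated. *)
Definition taffine n (a b : 'I_n -> R) (t : n.-tuple mR) : n.-tuple mR :=
  [tuple a i + b i * tnth t i | i < n].

Lemma measurable_taffine n (a b : 'I_n -> R) :
  measurable_fun [set: n.-tuple mR] (taffine a b).
Proof.
apply/measurable_fun_tnthP => i.
rewrite (_ : _ \o _ = (fun x : mR => a i + b i * x : mR) \o (@tnth n mR ^~ i)).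
  apply: measurableT_comp; first exact: measurable_affine.
  exact: measurable_tnth.
by apply/funext => t /=; rewrite tnth_mktuple.
Qed.

Lemma taffine_cons n (a b : 'I_n.+1 -> R) (p : mR * n.-tuple mR) :
  taffine a b (tuple_cons p) =
  tuple_cons (a ord0 + b ord0 * p.1,
    taffine (a \o lift ord0) (b \o lift ord0) p.2).
Proof.
apply: eq_from_tnth => i; rewrite tnth_mktuple.
case: (unliftP ord0 i) => [j|] ->.
  by rewrite !tnthS tnth_mktuple.
by rewrite !tnth0.
Qed.

Lemma lebesgue_tuple_affine n (a b : 'I_n -> R) (A : set (n.-tuple mR)) :
  (forall i, 0 < b i) -> measurable A ->
  ((\prod_i b i)%:E * lebesgue_tuple R n (taffine a b @^-1` A) =
   lebesgue_tuple R n A)%E.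
Proof.
elim: n a b A => [|n IH] a b A b0 mA.
  rewrite big_ord0 mul1e; congr (_ _); apply/seteqP.
  by split=> t /=; rewrite [taffine _ _ _]tuple0 [t]tuple0.
pose a' := a \o lift ord0; pose b' := b \o lift ord0.
pose Phi (p : mR * n.-tuple mR) : mR * n.-tuple mR :=
  (a ord0 + b ord0 * p.1, taffine a' b' p.2).
have mPhi : measurable_fun [set: mR * n.-tuple mR] Phi.
  apply/measurable_fun_pairP; split.
    by apply: (measurableT_comp (measurable_affine _ _)); exact: measurable_fst.
  by apply: (measurableT_comp (measurable_taffine _ _)); exact: measurable_snd.
have pb0 : 0 <= \prod_i b i by apply: prodr_ge0 => i _; exact/ltW.
pose nu : {measure set (mR * n.-tuple mR) -> \bar R} :=
  measure_function_pushforward__canonical__measure_function_Measure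
    (@lebesgue_measure R \x lebesgue_tuple R n)%E mPhi.
have mA' : measurable (@tuple_cons R n @^-1` A).
  by rewrite -[X in measurable X]setTI; exact: measurable_tuple_cons.
rewrite /= /lebesgue_cons /pushforward.
rewrite [RHS](product_measure_unique (m' := mscale (NngNum pb0) nu))//.
  rewrite /mscale/= /pushforward; congr (_ * _)%E; congr product_measure1.
  by apply/seteqP; split => p /=; rewrite taffine_cons.
move=> B C mB mC; rewrite [LHS](_ : _ = (\prod_i b i)%:E *
  (@lebesgue_measure R \x lebesgue_tuple R n) (Phi @^-1` (B `*` C)))%E//.
rewrite (_ : Phi @^-1` _ = [set x | B (a ord0 + b ord0 * x)] `*`
    (taffine a' b' @^-1` C)); last first.
  by apply/seteqP; split => -[x t]; case.
have m1 : measurable [set x : mR | B (a ord0 + b ord0 * x)].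
  by rewrite -[X in measurable X]setTI; exact: (measurable_affine _ _).
have m2 : measurable (taffine a' b' @^-1` C).
  by rewrite -[X in measurable X]setTI; exact: measurable_taffine.
rewrite product_measure1E//.
have e1 := lebesgue_measure_affine (a ord0) (b0 ord0) mB.
have e2 := IH a' b' C (fun i => b0 (lift ord0 i)) mC.
rewrite -[RHS](_ : ((b ord0)%:E * lebesgue_measure [set x | B (a ord0 + b ord0 * x)%R] *
    ((\prod_i b' i)%:E * lebesgue_tuple R n (taffine a' b' @^-1` C)) = _)%E); last first.
  by congr (_ * _)%E; [exact: e1|exact: e2].
by rewrite big_ord_recl EFinM muleACA.
Qed.

(** Half-open, so that a cut along a hyperplane is a true partition and no null sets have to be
    discarded. *)
Definition tbox n (a b : 'I_n -> R) : set (n.-tuple mR) :=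
  [set t | forall i, a i <= tnth t i < b i].

Lemma measurable_tbox n (a b : 'I_n -> R) : measurable (tbox a b).
Proof.
rewrite (_ : tbox a b = \bigcap_(i in [set: 'I_n])
    ((@tnth n mR ^~ i) @^-1` `[a i, b i[%classic)); last first.
  apply/seteqP; split => t /=; first by move=> h i _ /=; rewrite in_itv/=; exact: h.
  by move=> h i; have := h i I; rewrite /= in_itv.
apply: fin_bigcap_measurable => // i _.
by rewrite -[X in measurable X]setTI; apply: measurable_tnth => //; exact: measurable_itv.
Qed.

Lemma lebesgue_tuple_box n (a b : 'I_n -> R) : (forall i, a i <= b i) ->
  lebesgue_tuple R n (tbox a b) = (\prod_i (b i - a i))%:E.
Proof.
elim: n a b => [|n IH] a b ab.
  by rewrite big_ord0 /= diracE mem_set// => -[].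
pose a' := a \o lift ord0; pose b' := b \o lift ord0.
rewrite /= /lebesgue_cons /pushforward.
rewrite (_ : _ @^-1` _ = `[a ord0, b ord0[%classic `*` tbox a' b'); last first.
  apply/seteqP; split => -[x t] /=.
    move=> h; split => [|i]; first by rewrite in_itv/=; exact: (h ord0).
    by have := h (lift ord0 i); rewrite tnthS.
  rewrite in_itv/= => -[hx ht] i.
  by case: (unliftP ord0 i) => [j|] ->; [rewrite tnthS; exact: ht|rewrite tnth0].
rewrite product_measure1E//; last exact: measurable_tbox.
rewrite IH; last by move=> i; exact: ab.
rewrite big_ord_recl EFinM; congr (_ * _)%E.
apply: (etrans (lebesgue_measure_itv _)).
rewrite /= lte_fin; case: ifPn => [_|]; first by rewrite EFinB.
by rewrite -leNgt => ba; rewrite (@le_anti _ _ (a ord0) (b ord0)) ?subrr// ab ba.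
Qed.
End affine_measure.

(** * Real-valued volume, and its outer version for nonmeasurable sets *)

Section real_volume.
Context (R : realType) (n : nat).
Local Notation mR := (measurableTypeR R).
Local Notation mu := (lebesgue_tuple R n).
Implicit Types (A B S : set 'rV[R]_n).

Definition tpre A : set (n.-tuple mR) := [set t | A (\row_i tnth t i)].

Definition mes A : Prop := measurable (tpre A).

(** [fine] sends an infinite measure to [0], so identities for [vol] are transferred from [mu] only
    under finiteness. *)
Definition fmes A : Prop := mes A /\ (mu (tpre A) < +oo)%E.

Lemma mesI A B : mes A -> mes B -> mes (A `&` B).
Proof. exact: measurableI. Qed.

Lemma mesU A B : mes A -> mes B -> mes (A `|` B).
Proof. exact: measurableU. Qed.

Lemma mesD A B : mes A -> mes B -> mes (A `\` B).
Proof. exact: measurableD. Qed.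

Lemma mesC A : mes A -> mes (~` A).
Proof. exact: measurableC. Qed.

Lemma mes_bigcup (F : (set 'rV[R]_n)^nat) : (forall i, mes (F i)) -> mes (\bigcup_i F i).
Proof.
move=> mF; rewrite /mes (_ : tpre _ = \bigcup_i tpre (F i)); first exact: bigcupT_measurable.
by apply/seteqP; split.
Qed.

Lemma fmes_sub A B : mes A -> A `<=` B -> fmes B -> fmes A.
Proof.
move=> mA AB [mB fB]; split => //; apply: le_lt_trans fB.
by apply: le_measure; rewrite ?inE// => t; exact: AB.
Qed.

Lemma fmesIl A B : fmes A -> mes B -> fmes (A `&` B).
Proof.
by move=> fA mB; apply: (fmes_sub _ _ fA); [exact: mesI fA.1 mB|move=> x []].
Qed.

Lemma fmesD A B : fmes A -> mes B -> fmes (A `\` B).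
Proof.
by move=> fA mB; apply: (fmes_sub _ _ fA); [exact: mesD fA.1 mB|move=> x []].
Qed.

Lemma fmesU A B : fmes A -> fmes B -> fmes (A `|` B).
Proof.
move=> [mA fA] [mB fB]; split; first exact: mesU.
by apply: (le_lt_trans (measureU2 _ mA mB)); rewrite lte_add_pinfty.
Qed.

Lemma volE A : mes A -> vol A = fine (mu (tpre A)).
Proof. by move=> mA; rewrite /vol measurable_mu_extE. Qed.

Lemma EFin_vol A : fmes A -> (vol A)%:E = mu (tpre A).
Proof. by move=> [mA fA]; rewrite volE// fineK// ge0_fin_numE. Qed.

Lemma vol_ge0 A : 0 <= vol A.
Proof. by rewrite fine_ge0// mu_ext_ge0. Qed.

(** Only the larger set has to be measurable, so this also applies to the [l_0] boundary itself. *)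
Lemma le_vol_outer A B : A `<=` B -> fmes B -> vol A <= vol B.
Proof.
move=> AB [mB fB]; rewrite /vol.
have le : ((mu^*)%mu (tpre A) <= (mu^*)%mu (tpre B))%E by apply: le_mu_ext => t; exact: AB.
have fB' : ((mu^*)%mu (tpre B) < +oo)%E by rewrite measurable_mu_extE.
apply: fine_le => //; rewrite ge0_fin_numE ?mu_ext_ge0//.
exact: le_lt_trans fB'.
Qed.

Lemma volDI A B : fmes A -> mes B -> vol A = vol (A `\` B) + vol (A `&` B).
Proof.
move=> fA mB; apply: EFin_inj; rewrite EFinD !EFin_vol//.
- by rewrite [LHS](measureDI _ fA.1 mB).
- exact: fmesIl.
- exact: fmesD.
Qed.

Lemma volU_le A B : fmes A -> fmes B -> vol (A `|` B) <= vol A + vol B.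
Proof.
move=> fA fB; rewrite -lee_fin EFinD !EFin_vol//; last exact: fmesU.
exact: (measureU2 _ fA.1 fB.1).
Qed.

Lemma vol0 : vol (set0 : set 'rV[R]_n) = 0.
Proof. by rewrite volE ?(measure0 mu)//; exact: measurable0. Qed.

Lemma fmes0 : fmes set0.
Proof. by split; [exact: measurable0|rewrite (measure0 mu)]. Qed.

Lemma fmes_big_setU (I : Type) (s : seq I) (F : I -> set 'rV[R]_n) :
  (forall i, fmes (F i)) -> fmes (\big[setU/set0]_(i <- s) F i).
Proof.
move=> mF; elim: s => [|i s IH]; first by rewrite big_nil; exact: fmes0.
by rewrite big_cons; exact: fmesU.
Qed.

Lemma vol_big_setU_le (I : Type) (s : seq I) (F : I -> set 'rV[R]_n) :
  (forall i, fmes (F i)) ->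
  vol (\big[setU/set0]_(i <- s) F i) <= \sum_(i <- s) vol (F i).
Proof.
move=> mF; elim: s => [|i s IH]; first by rewrite !big_nil vol0.
rewrite !big_cons; apply: le_trans (volU_le _ _) _ => //; first exact: fmes_big_setU.
by rewrite lerD2l.
Qed.

(** Disjointness is taken from a pairwise relation on a list, the form in which couplings provide
    it. Removing [F i] from [A] does not affect the pieces that come later. *)
Lemma vol_sum_disjoint (I : Type) (d : rel I) (s : seq I) (F : I -> set 'rV[R]_n) A :
  pairwise d s -> (forall i j, d i j -> F i `&` F j = set0) ->
  (forall i, mes (F i)) -> fmes A ->
  \sum_(i <- s) vol (A `&` F i) <= vol A.
Proof.
move=> + dF mF; elim: s A => [|i s IH] A; first by rewrite big_nil vol_ge0.
move=> /= /andP[di ds] fA; rewrite big_cons (volDI fA (mF i)) addrC lerD2r.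
apply: le_trans (IH _ ds (fmesD fA (mF i))).
elim: s di {IH ds} => [|j s IH] /=; first by rewrite !big_nil.
move=> /andP[/dF ij /IH]; rewrite !big_cons; apply: lerD.
rewrite (_ : (A `\` F i) `&` F j = A `&` F j)//.
apply/seteqP; split => x; first by move=> [[]].
move=> [Ax Fj]; do 2?split => //; move=> Fi.
by have : (F i `&` F j) x by []; rewrite ij.
Qed.

Lemma tpre_affine (a b : 'I_n -> R) A :
  tpre [set x | A (\row_i (a i + b i * x 0 i))] = taffine a b @^-1` tpre A.
Proof.
apply/seteqP; split => t /=; rewrite /tpre/= => h.
  by move: h; congr (A _); apply/rowP => i; rewrite !mxE tnth_mktuple.
by move: h; congr (A _); apply/rowP => i; rewrite !mxE tnth_mktuple.
Qed.

Lemma mes_affine (a b : 'I_n -> R) A : mes A ->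
  mes [set x | A (\row_i (a i + b i * x 0 i))].
Proof.
move=> mA; rewrite /mes tpre_affine -[X in measurable X]setTI.
exact: measurable_taffine.
Qed.

Lemma fmes_affine (a b : 'I_n -> R) A : (forall i, 0 < b i) -> fmes A ->
  fmes [set x | A (\row_i (a i + b i * x 0 i))].
Proof.
move=> b0 [mA fA]; split; first exact: mes_affine.
have p0 : 0 < \prod_i b i by apply: prodr_gt0 => i _.
move: fA; rewrite -(lebesgue_tuple_affine a b0 mA) tpre_affine.
case: (mu _) => [r _|/=|//]; first exact: ltry.
by rewrite gt0_muley// lte_fin.
Qed.

Lemma vol_affine (a b : 'I_n -> R) A : (forall i, 0 < b i) -> fmes A ->
  (\prod_i b i) * vol [set x | A (\row_i (a i + b i * x 0 i))] = vol A.
Proof.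
move=> b0 fA; apply: EFin_inj; rewrite EFinM !EFin_vol//; last exact: fmes_affine.
by rewrite tpre_affine lebesgue_tuple_affine//; case: fA.
Qed.

Definition rbox (a b : 'I_n -> R) : set 'rV[R]_n :=
  [set x | forall i, a i <= x 0 i < b i].

Lemma tpre_rbox a b : tpre (rbox a b) = tbox a b.
Proof. by apply/seteqP; split => t /= h i; have := h i; rewrite mxE. Qed.

Lemma mes_rbox a b : mes (rbox a b).
Proof. by rewrite /mes tpre_rbox; exact: measurable_tbox. Qed.

Lemma vol_rbox a b : (forall i, a i <= b i) -> vol (rbox a b) = \prod_i (b i - a i).
Proof.
by move=> ab; rewrite volE ?tpre_rbox ?lebesgue_tuple_box//; exact: mes_rbox.
Qed.

Lemma fmes_rbox a b : (forall i, a i <= b i) -> fmes (rbox a b).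
Proof.
by move=> ab; split; [exact: mes_rbox|rewrite tpre_rbox lebesgue_tuple_box// ltry].
Qed.

(** An open set is the union of the boxes with rational centre and half-width [1 / (k + 1)] that it
    contains, and there are countably many of these. This links the topology to the product
    sigma-algebra. *)
Lemma mes_open A : open A -> mes A.
Proof.
move=> oA; pose I := ('rV[rat]_n * nat)%type.
pose c (q : I) : 'rV[R]_n := \row_i ratr (q.1 0 i).
pose h (q : I) : R := q.2.+1%:R^-1.
pose B (q : I) := rbox (fun i => c q 0 i - h q) (fun i => c q 0 i + h q).
pose F (q : I) := [set x | B q x /\ B q `<=` A].
have mF q : mes (F q).
  have [BA|BA] := pselect (B q `<=` A).
    by rewrite (_ : F q = B q); [exact: mes_rbox|apply/seteqP; split => x; [case|]].
  rewrite (_ : F q = set0); first exact: measurable0.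
  by apply/seteqP; split => x // -[].
rewrite /mes (_ : tpre A = \bigcup_q tpre (F q)).
  by apply: countable_bigcupT_measurable => [|q]; [exact: countableP|exact: mF].
apply/seteqP; split => t; last by move=> [q _ [Bt BA]]; exact: BA.
have -> : (\bigcup_q tpre (F q)) t = exists q, F q (\row_i tnth t i).
  by apply/propext; split=> [[q _ Fq]|[q Fq]]; exists q.
rewrite {1}/tpre/=; move: (\row_i _ : 'rV[R]_n) => {t} x Ax.
have := open_nbhs_nbhs (conj oA Ax).
move=> /nbhs_ballP[e /= e0 xeA].
have [k ke] : exists k, k.+1%:R^-1 < e / 2.
  have e2 : 0 < e / 2 by rewrite divr_gt0.
  exists (Num.truncn (e / 2)^-1).
  by rewrite invf_plt ?posrE//; exact: truncnS_gt.
have k0 : 0 < k.+1%:R^-1 :> R by rewrite invr_gt0.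
have [v vE] : exists v : R, v = k.+1%:R^-1 by exists k.+1%:R^-1.
rewrite -vE in ke k0.
have qP i : exists q : rat, x 0 i < ratr q < x 0 i + v.
  have : x 0 i < x 0 i + v by rewrite ltrDl.
  by move=> /rat_in_itvoo[q]; rewrite in_itv/= => qi; exists q.
have [f fP] := choice qP.
pose q : I := (\row_i f i, k).
have fP1 i : x 0 i < c q 0 i by rewrite /c !mxE; case/andP: (fP i).
have fP2 i : c q 0 i < x 0 i + v by rewrite /c !mxE; case/andP: (fP i).
have hq : h q = v by rewrite vE.
exists q; split=> [i|y By].
  have := fP1 i; have := fP2 i; rewrite /= hq; move: (c q 0 i) => u ? ?.
  by apply/andP; split; lra.
apply: xeA; split => // i j; rewrite ord1 -ball_normE /=.
have /andP[] := By j; have := fP1 j; have := fP2 j; rewrite /= hq.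
move: (c q 0 j) => u ? ? ? ?.
by rewrite ltr_norml; apply/andP; split; lra.
Qed.

Lemma mes_borel A : borel A -> mes A.
Proof.
move: A; apply: smallest_sub; last by move=> A; exact: mes_open.
split => /=.
- exact: measurable0.
- by move=> A mA; rewrite setTD; exact: mesC.
- by move=> F mF; exact: mes_bigcup.
Qed.

Lemma compact_box A : compact A ->
  exists B : R, 0 < B /\ forall x, A x -> forall i, - B <= x 0 i < B.
Proof.
move=> cA; have [M [_ AM]] := compact_bounded cA.
pose N := `|M| + 1.
have N0 : 0 <= N by rewrite addr_ge0.
exists (N + 1); split; first by rewrite ltr_wpDl.
move=> x Ax i.
have /= xN : `|x| <= N.
  by apply: AM => //; rewrite /N; have := ler_norm M; lra.
have : `|x 0 i| <= N.
  apply: le_trans xN; rewrite [leRHS]/Num.Def.normr/= mx_normrE.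
  by apply/bigmax_geP; right => /=; exists (0, i).
by rewrite ler_norml => /andP[? ?]; apply/andP; split; lra.
Qed.

Lemma compact_fmes A : compact A -> fmes A.
Proof.
move=> cA; have [B [B0 AB]] := compact_box cA.
apply: (@fmes_sub _ (rbox (fun=> - B) (fun=> B))) => //; last first.
  by apply: fmes_rbox => i; lra.
rewrite -[A]setCK; apply: mesC; apply: mes_open; apply: closed_openC.
by apply: compact_closed => //; exact: norm_hausdorff.
Qed.

(* [A] need not be measurable: its outer volume is approached by measurable
   supersets. *)
Lemma le_vol_outer_hull A B c : A `<=` B -> fmes B ->
  (forall M, fmes M -> A `<=` M -> M `<=` B -> c <= vol M) -> c <= vol A.
Proof.
move=> AB fB hM; apply/ler_addgt0Pr => e e0; rewrite /vol -/(tpre A).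
have fin : (mu^*)%mu (tpre A) \is a fin_num.
  rewrite ge0_fin_numE ?mu_ext_ge0//.
  apply: (@le_lt_trans _ _ ((mu^*)%mu (tpre B))).
    by apply: le_mu_ext => t; exact: AB.
  by rewrite measurable_mu_extE; case: fB.
have [_ [F [mF AF] <-] Fe] := lb_ereal_inf_adherent e0 fin.
pose utup (x : 'rV[R]_n) : n.-tuple mR := [tuple x 0 i | i < n].
pose M := [set x : 'rV[R]_n | (\bigcup_k F k) (utup x)] `&` B.
have tM : tpre M = (\bigcup_k F k) `&` tpre B.
  have utupK t : utup (\row_i tnth t i) = t.
    by apply: eq_from_tnth => i; rewrite tnth_mktuple mxE.
  by apply/seteqP; split => t; rewrite /M /tpre/= utupK.
have mM : mes M.
  by rewrite /mes tM; apply: measurableI; [exact: bigcupT_measurable|case: fB].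
have fM : fmes M by apply: fmes_sub fB => // x [].
apply: (@le_trans _ _ (vol M)).
  apply: hM => //; last by move=> x [].
  move=> x Ax; split; last exact: AB.
  apply: AF; rewrite /tpre/= (_ : \row_i _ = x)//.
  by apply/rowP => i; rewrite mxE tnth_mktuple.
rewrite -lee_fin EFin_vol// EFinD fineK//; apply: ltW; apply: le_lt_trans Fe.
rewrite tM; apply: (@measure_sigma_subadditive _ _ _ mu) => //.
by rewrite -tM.
Qed.

End real_volume.

(** * Monotone coupling of two finite unions of boxes *)

Section box_coupling.
Context (R : realType) (n : nat).
Local Notation box := ('rV[R]_n * 'rV[R]_n)%type.
Implicit Types (X Y Z : box) (s t : seq box) (a : R) (j : 'I_n).

Definition bvol X : R := \prod_i (X.2 0 i - X.1 0 i).
Definition bpos X : bool := [forall i, X.1 0 i < X.2 0 i].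
Definition bsub X Y : bool := [forall i, (Y.1 0 i <= X.1 0 i) && (X.2 0 i <= Y.2 0 i)].
Definition bsep X Y : bool :=
  [exists j, (X.2 0 j <= Y.1 0 j) || (Y.2 0 j <= X.1 0 j)].
Definition tvol s : R := \sum_(Z <- s) bvol Z.

(** One coordinate and one order serve both sources and targets; separating each family on its own
    would let the interpolations overlap. *)
Definition leafsep (l m : box * box) : bool :=
  [exists j, (l.1.2 0 j <= m.1.1 0 j) && (l.2.2 0 j <= m.2.1 0 j) ||
             (m.1.2 0 j <= l.1.1 0 j) && (m.2.2 0 j <= l.2.1 0 j)].

(** The third condition on a leaf says, by cross-multiplication, that it has the same share of both
    totals. The total over the targets then follows from that over the sources when [tvol s] is
    positive. *)
Definition coupling s t (L : seq (box * box)) : Prop :=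
  [/\ forall l, l \in L -> [/\ bpos l.1, bpos l.2,
        bvol l.1 * tvol t = bvol l.2 * tvol s &
        has (bsub l.1) s && has (bsub l.2) t],
      pairwise leafsep L & \sum_(l <- L) bvol l.1 = tvol s].

Lemma bvol_gt0 X : bpos X -> 0 < bvol X.
Proof. by move=> /forallP p; apply: prodr_gt0 => i _; rewrite subr_gt0. Qed.

Lemma tvol_gt0 s : all bpos s -> (0 < size s)%N -> 0 < tvol s.
Proof.
case: s => // X s /= /andP[pX ps] _; rewrite /tvol big_cons ltr_wpDr ?bvol_gt0//.
rewrite big_seq; apply: sumr_ge0 => Z /(allP ps) pZ.
by apply/ltW/bvol_gt0.
Qed.

Definition cutlo j a Z : box :=
  (Z.1, \row_i (if i == j then Num.min (Z.2 0 i) a else Z.2 0 i)).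
Definition cuthi j a Z : box :=
  (\row_i (if i == j then Num.max (Z.1 0 i) a else Z.1 0 i), Z.2).

(** Boxes that miss the half-space are dropped: the pieces stay nondegenerate, and the list gets
    shorter when the cut separates two of its boxes. *)
Definition lows j a s := [seq cutlo j a Z | Z <- s & Z.1 0 j < a].
Definition highs j a s := [seq cuthi j a Z | Z <- s & a < Z.2 0 j].

Definition brest j Z : R := \prod_(i | i != j) (Z.2 0 i - Z.1 0 i).

Lemma bvolE j Z : bvol Z = (Z.2 0 j - Z.1 0 j) * brest j Z.
Proof. by rewrite /bvol (bigD1 j). Qed.

Lemma bvol_cutlo j a Z :
  bvol (cutlo j a Z) = (Num.min (Z.2 0 j) a - Z.1 0 j) * brest j Z.
Proof.
rewrite (bvolE j) /= mxE eqxx; congr (_ * _).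
by apply: eq_bigr => i /negbTE ij; rewrite mxE ij.
Qed.

Lemma bvol_cuthi j a Z :
  bvol (cuthi j a Z) = (Z.2 0 j - Num.max (Z.1 0 j) a) * brest j Z.
Proof.
rewrite (bvolE j) /= mxE eqxx; congr (_ * _).
by apply: eq_bigr => i /negbTE ij; rewrite mxE ij.
Qed.

(** The clamp vanishes on the boxes that [lows] drops. The volume below the cut becomes a sum over a
    fixed list, continuous in [a], as the intermediate value theorem requires. *)
Lemma tvol_lows j a s : all bpos s -> tvol (lows j a s) =
  \sum_(Z <- s) (Num.min (Num.max a (Z.1 0 j)) (Z.2 0 j) - Z.1 0 j) * brest j Z.
Proof.
move=> ps; rewrite /tvol big_map big_filter big_mkcond /= big_seq [RHS]big_seq.
apply: eq_bigr => Z /(allP ps)/forallP/(_ j) pZ; rewrite bvol_cutlo.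
case: ifPn => [za|]; first by rewrite (max_l (ltW za)) minC.
by rewrite -leNgt => az; rewrite (max_r az) (min_l (ltW pZ)) subrr mul0r.
Qed.

Lemma tvol_lows_highs j a s : all bpos s ->
  tvol (lows j a s) + tvol (highs j a s) = tvol s.
Proof.
move=> ps; rewrite tvol_lows// /tvol big_map big_filter [X in _ + X]big_mkcond.
rewrite -big_split /= big_seq [RHS]big_seq.
apply: eq_bigr => Z /(allP ps)/forallP/(_ j) pZ; rewrite bvol_cuthi (bvolE j).
case: ifPn => [az|]; rewrite ?addr0 -?mulrDl; last rewrite -leNgt => za.
  rewrite (@min_l _ _ _ (Z.2 0 j)) ?ge_max ?(ltW az) ?(ltW pZ)// maxC.
  by congr (_ * _); ring.
by rewrite (@min_r _ _ _ (Z.2 0 j))// le_max za.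
Qed.

Lemma bpos_lows j a s : all bpos s -> all bpos (lows j a s).
Proof.
move=> /allP ps; apply/allP => W /mapP[Z]; rewrite mem_filter => /andP[za /ps/forallP pZ] ->{W}.
by apply/forallP => i /=; rewrite mxE; case: eqP => // ->; rewrite lt_min pZ.
Qed.

Lemma bpos_highs j a s : all bpos s -> all bpos (highs j a s).
Proof.
move=> /allP ps; apply/allP => W /mapP[Z]; rewrite mem_filter => /andP[za /ps/forallP pZ] ->{W}.
by apply/forallP => i /=; rewrite mxE; case: eqP => // ->; rewrite gt_max pZ.
Qed.

Lemma bsub_cutlo j a Z : bsub (cutlo j a Z) Z.
Proof. by apply/forallP => i /=; rewrite mxE lexx; case: ifP; rewrite ?ge_min lexx. Qed.

Lemma bsub_cuthi j a Z : bsub (cuthi j a Z) Z.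
Proof. by apply/forallP => i /=; rewrite mxE lexx andbT; case: ifP; rewrite ?le_max lexx. Qed.

Lemma bsub_trans Y X Z : bsub X Y -> bsub Y Z -> bsub X Z.
Proof.
move=> /forallP XY /forallP YZ; apply/forallP => i.
have /andP[? ?] := XY i; have /andP[? ?] := YZ i.
by apply/andP; split; [apply: (@le_trans _ _ (Y.1 0 i))|apply: (@le_trans _ _ (Y.2 0 i))].
Qed.

Lemma bsep_sub X Y X' Y' : bsub X' X -> bsub Y' Y -> bsep X Y -> bsep X' Y'.
Proof.
move=> /forallP hX /forallP hY /existsP[j h]; apply/existsP; exists j.
have /andP[? ?] := hX j; have /andP[? ?] := hY j.
by case/orP: h => h; apply/orP; [left|right]; lra.
Qed.

Lemma pairwise_cut s (P : pred box) (f : box -> box) :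
  (forall Z, bsub (f Z) Z) -> pairwise bsep s ->
  pairwise bsep [seq f Z | Z <- s & P Z].
Proof.
move=> fs ps; rewrite pairwise_map; apply: pairwise_filter.
by apply: sub_pairwise ps => X Y; exact: bsep_sub.
Qed.

Lemma has_bsub_cut s (P : pred box) (f : box -> box) X :
  (forall Z, bsub (f Z) Z) -> has (bsub X) [seq f Z | Z <- s & P Z] ->
  has (bsub X) s.
Proof.
move=> fs /hasP[W /mapP[Z]]; rewrite mem_filter => /andP[_ Zs] ->{W} XZ.
by apply/hasP; exists Z => //; exact: bsub_trans XZ (fs Z).
Qed.

Lemma has_bsub_lows j a s X : has (bsub X) (lows j a s) -> X.2 0 j <= a.
Proof.
move=> /hasP[W /mapP[Z _ ->{W}]] /forallP/(_ j)/andP[_] /=; rewrite mxE eqxx.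
by rewrite le_min => /andP[].
Qed.

Lemma has_bsub_highs j a s X : has (bsub X) (highs j a s) -> a <= X.1 0 j.
Proof.
move=> /hasP[W /mapP[Z _ ->{W}]] /forallP/(_ j)/andP[+ _] /=; rewrite mxE eqxx.
by rewrite ge_max => /andP[].
Qed.

Lemma continuous_minr (b : R) : continuous (fun x : R => Num.min x b).
Proof.
rewrite (_ : (fun x => _) = fun x => (x + b - `|x - b|) / 2); last first.
  by apply/funext => x; rewrite minr_absE.
move=> x; apply: cvgMl; apply: cvgB; first by apply: cvgD => //; exact: cvg_cst.
by apply: cvg_norm; apply: cvgB => //; exact: cvg_cst.
Qed.

Lemma continuous_maxr (b : R) : continuous (fun x : R => Num.max x b).
Proof.
rewrite (_ : (fun x => _) = fun x => (x + b + `|x - b|) / 2); last first.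
  by apply/funext => x; rewrite maxr_absE.
move=> x; apply: cvgMl; apply: cvgD; first by apply: cvgD => //; exact: cvg_cst.
by apply: cvg_norm; apply: cvgB => //; exact: cvg_cst.
Qed.

Lemma tvol_cut_ivt j s c : all bpos s -> 0 <= c <= tvol s ->
  exists b, tvol (lows j b s) = c.
Proof.
move=> ps /andP[c0 cs].
pose g (x : R) := \sum_(Z <- s)
  (Num.min (Num.max x (Z.1 0 j)) (Z.2 0 j) - Z.1 0 j) * brest j Z.
have cg : continuous g.
  rewrite /g; elim: s {ps cs g} => [|Z s IH] x.
    rewrite (_ : (fun _ => _) = cst 0); first exact: cvg_cst.
    by apply/funext => y; rewrite big_nil.
  pose h (y : R) := (Num.min (Num.max y (Z.1 0 j)) (Z.2 0 j) - Z.1 0 j) * brest j Z.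
  rewrite (_ : (fun _ => _) = h \+ (fun y => \sum_(Z <- s)
     (Num.min (Num.max y (Z.1 0 j)) (Z.2 0 j) - Z.1 0 j) * brest j Z)); last first.
    by apply/funext => y; rewrite big_cons.
  apply: cvgD; last exact: IH.
  apply: cvgMl; apply: cvgB; last exact: cvg_cst.
  apply: (@continuous_comp _ _ _ (fun x => Num.max x (Z.1 0 j)) (fun x => Num.min x (Z.2 0 j))).
    exact: continuous_maxr.
  exact: continuous_minr.
have [lo [hi [lohi los]]] : exists lo hi : R, lo <= hi /\
    forall Z, Z \in s -> lo <= Z.1 0 j /\ Z.2 0 j <= hi.
  elim: s {c cs c0 g cg ps} => [|Z s [lo [hi [lohi IH]]]]; first by exists 0, 0.
  exists (Num.min lo (Z.1 0 j)), (Num.max hi (Z.2 0 j)); split.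
    by rewrite ge_min le_max lohi.
  move=> Y; rewrite in_cons => /orP[/eqP ->|/IH[? ?]].
    by rewrite ge_min le_max !lexx !orbT.
  by rewrite ge_min le_max; split; apply/orP; left.
have glo : g lo = 0.
  rewrite /g big_seq big1// => Z Zs; have [loZ _] := los _ Zs.
  have /forallP/(_ j) pZ := allP ps _ Zs.
  by rewrite (max_r loZ) (min_l (ltW pZ)) subrr mul0r.
have ghi : g hi = tvol s.
  rewrite /g /tvol big_seq [RHS]big_seq; apply: eq_bigr => Z Zs.
  have [_ hiZ] := los _ Zs.
  by rewrite (bvolE j) min_r// le_max hiZ.
have : Num.min (g lo) (g hi) <= c <= Num.max (g lo) (g hi).
  have := le_trans c0 cs; rewrite glo ghi => s0.
  by rewrite (min_l s0) (max_r s0) c0.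
move=> /(IVT lohi (continuous_subspaceT cg))[b _ gb].
by exists b; rewrite tvol_lows.
Qed.

Lemma coupling_sym s t L : coupling s t L -> (0 < tvol s) ->
  coupling t s [seq (l.2, l.1) | l <- L].
Proof.
move=> [hL pL sL] s0; split.
- move=> m /mapP[l /hL[p1 p2 e h]] ->{m}; split => //=.
  by rewrite andbC.
- rewrite pairwise_map; apply: sub_pairwise pL => l m /= /existsP[j h].
  by apply/existsP; exists j => /=; rewrite [X in X || _]andbC [X in _ || X]andbC.
- rewrite big_map /=; apply: (mulIf (lt0r_neq0 s0)).
  rewrite mulr_suml -[in RHS]sL mulr_sumr big_seq [RHS]big_seq.
  by apply: eq_bigr => l /hL[_ _ <- _]; rewrite mulrC.
Qed.

(* Hadwiger-Ohmann induction on the number of boxes: cut [s] along a hyperplane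
   separating two of its boxes and [t] along the parallel hyperplane leaving the
   same proportion on each side; leaves on different sides of a cut are separated
   in the same coordinate and in the same order in source and target. *)
Lemma coupling_exists s t : all bpos s -> all bpos t ->
  pairwise bsep s -> pairwise bsep t -> (0 < size s)%N -> (0 < size t)%N ->
  exists L, coupling s t L.
Proof.
have [N] := ubnP (size s + size t).
elim: N s t => // N IH s t; rewrite ltnS => stN ps pt ds dt s0 t0.
(* If only [t] has several boxes, the roles are exchanged; two single boxes form one leaf. *)
wlog s2 : s t stN ps pt ds dt s0 t0 / (1 < size s)%N.
  move=> H; have [s2|s1] := ltnP 1 (size s); first exact: (H s t).
  have [t2|t1] := ltnP 1 (size t).
    have [||||||||L cL] := H t s => //; first by rewrite addnC.
    by exists [seq (l.2, l.1) | l <- L]; apply: coupling_sym => //; exact: tvol_gt0.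
  case: s s0 s1 {stN H ds} ps => [//|X [|//]] _ _ /= /andP[pX _].
  case: t t0 t1 {dt} pt => [//|Y [|//]] _ _ /= /andP[pY _].
  exists [:: (X, Y)]; split => //.
  - move=> l; rewrite inE => /eqP -> /=; rewrite /tvol !big_seq1 !orbF mulrC.
    by split => //; apply/andP; split; apply/forallP => i; rewrite !lexx.
  - by rewrite /tvol !big_seq1.
have sv := tvol_gt0 ps s0; have tv := tvol_gt0 pt t0.
(* Cutting at the upper face of the lower of two separated boxes leaves one of them on each side, so
   both halves of [s] are nonempty and shorter, while those of [t] are no longer than [t]. *)
have [j [a [slo shi]]] : exists j a,
    (0 < size (lows j a s) < size s)%N /\ (0 < size (highs j a s) < size s)%N.
  case: s s2 ps ds {stN s0 sv} => [//|X [//|Y s]] _ /= /and3P[pX pY ps] /andP[/andP[XY _] _].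
  case/existsP: XY => j h; exists j.
  have /forallP/(_ j) pXj := pX; have /forallP/(_ j) pYj := pY.
  have sz (P : pred box) : (size [seq Z <- s | P Z] < (size s).+1)%N.
    by rewrite ltnS size_filter count_size.
  case/orP: h => h; [exists (X.2 0 j)|exists (Y.2 0 j)]; rewrite !size_map /=.
  - by rewrite pXj (ltNge (Y.1 0 j)) h ltxx (le_lt_trans h pYj) /= !ltnS !size_filter !count_size.
  - by rewrite pYj (ltNge (X.1 0 j)) h ltxx (le_lt_trans h pXj) /= !ltnS !size_filter !count_size.
have lv : 0 < tvol (lows j a s) by apply: tvol_gt0; [exact: bpos_lows|case/andP: slo].
have hv : 0 < tvol (highs j a s) by apply: tvol_gt0; [exact: bpos_highs|case/andP: shi].
have lhv := tvol_lows_highs j a ps.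
(* As [t] is cut in the same proportion, [lam] (or [1 - lam]) cancels from the mass identity of
   every leaf. *)
pose lam := tvol (lows j a s) / tvol s.
have lam0 : 0 < lam by rewrite divr_gt0.
have lam1 : lam < 1 by rewrite ltr_pdivrMr// mul1r -lhv ltrDl.
have [b tb] : exists b, tvol (lows j b t) = lam * tvol t.
  apply: tvol_cut_ivt => //; rewrite (ltW (mulr_gt0 lam0 tv))/=.
  by rewrite ler_piMl// ltW.
have tb' : tvol (highs j b t) = (1 - lam) * tvol t.
  by rewrite mulrBl mul1r -tb -(tvol_lows_highs j b pt) addrC addKr.
have sl : tvol (lows j a s) = lam * tvol s by rewrite divfK// gt_eqF.
have sh : tvol (highs j a s) = (1 - lam) * tvol s.
  by rewrite mulrBl mul1r -sl -lhv addrC addKr.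
have nonempty u : 0 < tvol u -> (0 < size u)%N.
  by case: u => //; rewrite /tvol big_nil ltxx.
have szt (P : pred box) (f : box -> box) : (size [seq f Z | Z <- t & P Z] <= size t)%N.
  by rewrite size_map size_filter count_size.
have [|||||||L1 [h1 p1 s1]] := IH (lows j a s) (lows j b t).
- apply: leq_trans stN; rewrite -addSn leq_add//; first by case/andP: slo.
  exact: szt.
- exact: bpos_lows.
- exact: bpos_lows.
- by apply: pairwise_cut => // Z; exact: bsub_cutlo.
- by apply: pairwise_cut => // Z; exact: bsub_cutlo.
- exact: nonempty.
- by apply: nonempty; rewrite tb mulr_gt0.
have [|||||||L2 [h2 p2 s2']] := IH (highs j a s) (highs j b t).
- apply: leq_trans stN; rewrite -addSn leq_add//; first by case/andP: shi.
  exact: szt.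
- exact: bpos_highs.
- exact: bpos_highs.
- by apply: pairwise_cut => // Z; exact: bsub_cuthi.
- by apply: pairwise_cut => // Z; exact: bsub_cuthi.
- exact: nonempty.
- by apply: nonempty; rewrite tb' mulr_gt0// subr_gt0.
exists (L1 ++ L2); split.
- move=> l; rewrite mem_cat => /orP[/h1|/h2] [q1 q2 e /andP[k1 k2]]; split => //.
  + by move: e; rewrite tb sl !(mulrCA _ lam) => /(mulfI (lt0r_neq0 lam0)).
  + by apply/andP; split; [apply: has_bsub_cut k1|apply: has_bsub_cut k2];
      move=> Z; exact: bsub_cutlo.
  + by move: e; rewrite tb' sh !(mulrCA _ (1 - lam)); apply: mulfI; rewrite gt_eqF// subr_gt0.
  + by apply/andP; split; [apply: has_bsub_cut k1|apply: has_bsub_cut k2];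
      move=> Z; exact: bsub_cuthi.
- rewrite pairwise_cat p1 p2 !andbT; apply/allrelP => l m /h1[_ _ _ /andP[l1 l2]].
  move=> /h2[_ _ _ /andP[m1 m2]]; apply/existsP; exists j; apply/orP; left.
  by rewrite (le_trans (has_bsub_lows l1) (has_bsub_highs m1))
             (le_trans (has_bsub_lows l2) (has_bsub_highs m2)).
- by rewrite big_cat /= s1 s2'.
Qed.

End box_coupling.

Arguments bpos {R n} X.
Arguments bsep {R n} X Y.
Arguments leafsep {R n} l m.
Arguments bvol {R n} X.
Arguments bsub {R n} X Y.

(** * Approximation of bounded measurable sets by finite unions of boxes *)

Section box_approximation.
Context (R : realType) (n : nat).
Local Notation mR := (measurableTypeR R).
Local Notation mu := (lebesgue_tuple R n).
Local Notation box := ('rV[R]_n * 'rV[R]_n)%type.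
Implicit Types (X Y Z : box) (s t : seq box) (A B D W : set 'rV[R]_n).

Lemma vol_bigcup_tail (F : (set 'rV[R]_n)^nat) W e : (forall i, mes (F i)) ->
  (forall i j, (i <= j)%N -> F i `<=` F j) -> fmes W -> 0 < e ->
  exists k, vol (W `&` (\bigcup_i F i `\` F k)) <= e.
Proof.
move=> mF ndF fW e0.
pose G k := tpre (W `&` F k).
have mG k : measurable (G k) by apply: mesI (mF k); case: fW.
have GU : \bigcup_k G k = tpre (W `&` \bigcup_i F i).
  apply/seteqP; split => [t [k _ [Wt Ft]]|t [Wt [k _ Ft]]].
    by split => //; exists k.
  by exists k.
have fWU : fmes (W `&` \bigcup_i F i) by apply: fmesIl => //; exact: mes_bigcup.
have : (mu \o G) k @[k --> \oo] --> mu (\bigcup_k G k).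
  apply: nondecreasing_cvg_mu => //; first exact: bigcupT_measurable.
  move=> i j ij; apply/subsetPset => t [Wt Ft]; split => //.
  exact: (ndF _ _ ij).
have fG k : fmes (W `&` F k) by exact: fmesIl.
rewrite GU -EFin_vol// => /fine_cvgP[_] /cvgrPdist_lt /(_ _ e0)[k _ hk].
exists k; have := hk k (leqnn k).
rewrite /= -EFin_vol//= (volDI fWU (mF k)).
rewrite (_ : (W `&` \bigcup_i F i) `&` F k = W `&` F k); last first.
  by apply/seteqP; split => x; [move=> [[]]|move=> [Wx Fx]; split => //; split => //; exists k].
rewrite addrK ger0_norm ?vol_ge0// => /ltW; congr (vol _ <= _).
by apply/seteqP; split => x; [move=> [[]]|move=> [? []]].
Qed.

Definition bset Z : set 'rV[R]_n := rbox (Z.1 0) (Z.2 0).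

Definition bunion s : set 'rV[R]_n := \big[setU/set0]_(Z <- s) bset Z.

Lemma bunionP s x : bunion s x <-> exists2 Z, Z \in s & bset Z x.
Proof.
rewrite /bunion -bigcup_seq; split => [[Z Zs Zx]|[Z Zs Zx]]; by exists Z.
Qed.

Lemma fmes_bset Z : bpos Z -> fmes (bset Z).
Proof. by move=> /forallP p; apply: fmes_rbox => i; exact/ltW. Qed.

Lemma mes_bset Z : mes (bset Z).
Proof. exact: mes_rbox. Qed.

Lemma vol_bset Z : bpos Z -> vol (bset Z) = bvol Z.
Proof. by move=> /forallP p; rewrite vol_rbox// => i; exact/ltW. Qed.

Lemma bsep_disjoint X Y : bsep X Y -> bset X `&` bset Y = set0.
Proof.
move=> /existsP[j h]; apply/seteqP; split => // x [/(_ j)/andP[? ?] /(_ j)/andP[? ?]].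
by case/orP: h => h; exfalso; lra.
Qed.

Lemma disjoint_bsep X Y : bpos X -> bpos Y -> bset X `&` bset Y = set0 -> bsep X Y.
Proof.
move=> /forallP pX /forallP pY XY; apply: contrapT => /negP/existsPn h.
have : (bset X `&` bset Y) (\row_i Num.max (X.1 0 i) (Y.1 0 i)).
  split => i; have := h i; rewrite negb_or -!ltNge => /andP[h1 h2].
    by rewrite mxE le_max gt_max lexx pX h1.
  by rewrite mxE le_max gt_max lexx orbT pY h2.
by rewrite XY.
Qed.

Lemma fmes_bunion s : all bpos s -> fmes (bunion s).
Proof.
rewrite /bunion; elim: s => [_|Z s IH /= /andP[pZ ps]].
  by rewrite big_nil; exact: fmes0.
by rewrite big_cons; apply: fmesU; [exact: fmes_bset|exact: IH].
Qed.

Lemma vol_bunion s : all bpos s -> pairwise bsep s -> vol (bunion s) = tvol s.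
Proof.
elim: s => [_ _|Z s IH /= /andP[pZ ps] /andP[dZ ds]].
  by rewrite /bunion /tvol !big_nil vol0.
have fZs : fmes (bunion (Z :: s)) by apply: fmes_bunion; rewrite /= pZ.
rewrite (volDI fZs (mes_bset Z)) /tvol big_cons addrC -(vol_bset pZ) -/(tvol s) -(IH ps ds).
have dis x : bunion s x -> bset Z x -> False.
  move=> /bunionP[Y Ys Yx] Zx; have /bsep_disjoint ZY := allP dZ _ Ys.
  by have : (bset Z `&` bset Y) x by []; rewrite ZY.
congr (_ + _); congr vol.
- apply/seteqP; split => [x []//|x Zx]; split => //.
  by rewrite /bunion big_cons; left.
- rewrite /bunion big_cons; apply/seteqP; split => [x [[]]//|x sx].
  by split; [right|exact: dis].
Qed.

Definition boxable D : Prop :=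
  exists s, [/\ all bpos s, pairwise bsep s & bunion s = D].

Lemma boxable0 : boxable set0.
Proof. by exists [::]; split => //; rewrite /bunion big_nil. Qed.

Lemma boxableU D D' : boxable D -> boxable D' -> D `&` D' = set0 -> boxable (D `|` D').
Proof.
move=> [s [ps ds <-]] [t [pt dt <-]] st; exists (s ++ t); split.
- by rewrite all_cat ps.
- rewrite pairwise_cat ds dt !andbT; apply/allrelP => X Y Xs Yt.
  apply: disjoint_bsep; [exact: (allP ps)|exact: (allP pt)|].
  apply/seteqP; split => // x [Xx Yx].
  have : (bunion s `&` bunion t) x by split; apply/bunionP; [exists X|exists Y].
  by rewrite st.
- by rewrite /bunion big_cat.
Qed.

Lemma boxable_lows j (a : R) D : boxable D -> boxable (D `&` [set x | x 0 j < a]).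
Proof.
move=> [s [ps ds <-]]; exists (lows j a s); split.
- exact: bpos_lows.
- by apply: pairwise_cut => // Z; exact: bsub_cutlo.
- apply/seteqP; split => x.
    move=> /bunionP[W /mapP[Z]]; rewrite mem_filter => /andP[_ Zs] ->{W} h.
    split; first (apply/bunionP; exists Z => // i).
      by have /= := h i; rewrite mxE; case: eqP => [->|//]; rewrite lt_min andbA => /andP[].
    by have /= := h j; rewrite mxE eqxx lt_min => /and3P[].
  move=> [/bunionP[Z Zs Zx] /= xa]; apply/bunionP; exists (cutlo j a Z).
    apply/mapP; exists Z => //; rewrite mem_filter Zs andbT.
    by have /andP[+ _] := Zx j; move/le_lt_trans; apply.
  move=> i /=; rewrite mxE; case: eqP => [->|_]; last exact: Zx.
  by rewrite lt_min andbA xa andbT; exact: Zx.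
Qed.

Lemma boxable_highs j (a : R) D : boxable D -> boxable (D `&` [set x | a <= x 0 j]).
Proof.
move=> [s [ps ds <-]]; exists (highs j a s); split.
- exact: bpos_highs.
- by apply: pairwise_cut => // Z; exact: bsub_cuthi.
- apply/seteqP; split => x.
    move=> /bunionP[W /mapP[Z]]; rewrite mem_filter => /andP[_ Zs] ->{W} h.
    split; first (apply/bunionP; exists Z => // i).
      by have /= := h i; rewrite mxE; case: eqP => [->|//]; rewrite ge_max -andbA => /and3P[-> _ ->].
    by have /= := h j; rewrite mxE eqxx ge_max => /andP[/andP[]].
  move=> [/bunionP[Z Zs Zx] /= xa]; apply/bunionP; exists (cuthi j a Z).
    apply/mapP; exists Z => //; rewrite mem_filter Zs andbT.
    by have /andP[_ +] := Zx j; apply: le_lt_trans.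
  move=> i /=; rewrite mxE; case: eqP => [->|_]; last exact: Zx.
  by rewrite ge_max -andbA xa /=; exact: Zx.
Qed.

Lemma boxableD_box D Y : bpos Y -> boxable D -> boxable (D `\` bset Y).
Proof.
move=> /forallP pY rD.
(* The box is replaced by a cylinder over a list of coordinates. Each coordinate splits [D] into the
   part below, the part above and a slab, in which the remaining coordinates are treated. *)
suff H (js : seq 'I_n) : boxable (D `\` [set x | forall j, j \in js -> Y.1 0 j <= x 0 j < Y.2 0 j]).
  have := H (enum 'I_n); congr (boxable (_ `\` _)).
  by apply/seteqP; split => x /= h i; first apply: h; rewrite ?mem_enum//; move=> _; exact: h.
elim: js D rD => [|j js IH] D rD.
  rewrite (_ : _ `\` _ = set0); first exact: boxable0.
  by apply/seteqP; split => x // [_ h]; exfalso; apply: h.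
have r1 := boxable_lows j (Y.1 0 j) rD.
have r2 := boxable_highs j (Y.1 0 j) rD.
have r3 := IH _ (boxable_lows j (Y.2 0 j) r2).
have r4 := boxable_highs j (Y.2 0 j) r2.
rewrite (_ : D `\` _ = (D `&` [set x | x 0 j < Y.1 0 j]) `|`
   (((D `&` [set x | Y.1 0 j <= x 0 j]) `&` [set x | x 0 j < Y.2 0 j]) `\`
      [set x | forall j, j \in js -> Y.1 0 j <= x 0 j < Y.2 0 j] `|`
    ((D `&` [set x | Y.1 0 j <= x 0 j]) `&` [set x | Y.2 0 j <= x 0 j]))).
  apply: boxableU => //.
    apply: boxableU => //.
    by apply/seteqP; split => // x [[[_ /= h] _] [_ /=]]; rewrite leNgt h.
  apply/seteqP; split => // x [[_ /= h] [[[[_ /=]]]|[[_ /=]]]]; by rewrite leNgt h.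
apply/seteqP; split => x.
  move=> [Dx h]; have [x1|x1] := ltP (x 0 j) (Y.1 0 j); first by left.
  right; have [x2|x2] := ltP (x 0 j) (Y.2 0 j); last by right.
  left; split => // k; apply: h => i; rewrite in_cons => /orP[/eqP ->|]; last exact: k.
  by rewrite x1 x2.
move=> [[Dx /= x1]|[[[[Dx /= x1] /= x2] h]|[[Dx /= x1] /= x2]]]; split => // k.
- by have := k j (mem_head _ _); rewrite leNgt x1.
- by apply: h => i ijs; apply: k; rewrite in_cons ijs orbT.
- by have := k j (mem_head _ _); rewrite ltNge x2 andbF.
Qed.

Lemma boxableD D D' : boxable D -> boxable D' -> boxable (D `\` D').
Proof.
move=> + [s [ps _ <-]]; elim: s ps D => [_|Y s IH /= /andP[pY ps]] D rD.
  by rewrite /bunion big_nil setD0.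
rewrite /bunion big_cons -setDDl; apply: IH => //; exact: boxableD_box.
Qed.

Lemma boxable_fmes D : boxable D -> fmes D.
Proof. by move=> [s [ps _ <-]]; exact: fmes_bunion. Qed.

Section fixed_window.
Variable W : set 'rV[R]_n.
Hypothesis rW : boxable W.

(** Finite unions of boxes are bounded and complements are not; comparing inside a window [W] makes
    the class stable under complement. *)
Definition approximable A : Prop := mes A /\ forall e, 0 < e -> exists D,
  [/\ boxable D, D `<=` W & vol ((A `&` W) `\` D) + vol (D `\` A) <= e].

Let fW : fmes W := boxable_fmes rW.

Lemma approximable0 : approximable set0.
Proof.
split=> [|e e0]; first exact: measurable0.
by exists set0; split; [exact: boxable0|exact: sub0set|rewrite set0I !set0D vol0 addr0 ltW].
Qed.

Lemma approximableC A : approximable A -> approximable (~` A).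
Proof.
move=> [mA hA]; split=> [|e e0]; first exact: mesC.
(* Under complement the two error terms exchange their roles. *)
have [D [rD DW h]] := hA e e0; exists (W `\` D); split.
- exact: boxableD.
- by move=> x [].
- apply: le_trans h; rewrite addrC; apply: lerD; apply: le_vol_outer.
  + by move=> x [[Wx Dx] /contrapT].
  + by apply: fmesD; [apply: fmes_sub fW => [|x [] //]; apply: mesI => //; case: fW|case: (boxable_fmes rD)].
  + by move=> x [[nA Wx] nD]; split=> //; apply: contrapT => Dx; apply: nD.
  + by apply: fmesD => //; exact: boxable_fmes.
Qed.

Lemma approximableU A B : approximable A -> approximable B -> approximable (A `|` B).
Proof.
move=> [mA hA] [mB hB]; split=> [|e e0]; first exact: mesU.
have e2 : 0 < e / 2 by lra.
have [D [rD DW hD]] := hA _ e2; have [E [rE EW hE]] := hB _ e2.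
have fD := boxable_fmes rD; have fE := boxable_fmes rE.
exists (D `|` (E `\` D)); split.
- by apply: boxableU => //; [exact: boxableD|rewrite setDIK].
- by move=> x [/DW//|[/EW]].
- have fAW : fmes (A `&` W) by apply: fmes_sub fW => [|x [] //]; apply: mesI => //; case: fW.
  have fBW : fmes (B `&` W) by apply: fmes_sub fW => [|x [] //]; apply: mesI => //; case: fW.
  have f1 : fmes ((A `&` W) `\` D) by apply: fmesD => //; case: fD.
  have f2 : fmes ((B `&` W) `\` E) by apply: fmesD => //; case: fE.
  have f3 : fmes (D `\` A) by apply: fmesD.
  have f4 : fmes (E `\` B) by apply: fmesD.
  have : vol (((A `|` B) `&` W) `\` (D `|` (E `\` D))) <=
         vol ((A `&` W) `\` D) + vol ((B `&` W) `\` E).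
    apply: le_trans (volU_le f1 f2); apply: le_vol_outer; last exact: fmesU.
    move=> x [[ABx Wx] nDE].
    have [Dx|nD] := pselect (D x); first by exfalso; apply: nDE; left.
    have [Ex|nE] := pselect (E x); first by exfalso; apply: nDE; right.
    by case: ABx => ?; [left|right].
  have : vol ((D `|` (E `\` D)) `\` (A `|` B)) <= vol (D `\` A) + vol (E `\` B).
    apply: le_trans (volU_le f3 f4); apply: le_vol_outer; last exact: fmesU.
    move=> x [[Dx|[Ex _]] nAB]; [left|right]; split => // ?; apply: nAB; [left|right]; done.
  lra.
Qed.

Lemma approximable_bigcup (F : (set 'rV[R]_n)^nat) : (forall i, approximable (F i)) -> approximable (\bigcup_i F i).
Proof.
move=> aF; have mF i : mes (F i) by case: (aF i).
split=> [|e e0]; first exact: mes_bigcup.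
pose G k := \big[setU/set0]_(i < k) F i.
have aG k : approximable (G k).
  elim: k => [|k IH]; first by rewrite /G big_ord0; exact: approximable0.
  by rewrite /G big_ord_recr; exact: approximableU.
have mG k : mes (G k) by case: (aG k).
have GU : \bigcup_k G k = \bigcup_i F i.
  apply/seteqP; split => [x [k _]|x [i _ Fx]].
    by rewrite /G -bigcup_mkord => -[i _ Fx]; exists i.
  by exists i.+1 => //; rewrite /G big_ord_recr; right.
have ndG i j : (i <= j)%N -> G i `<=` G j.
  by move=> ij; rewrite /G -!bigcup_mkord => x [k /= ki Fx]; exists k => //=; exact: leq_trans ij.
have e2 : 0 < e / 2 by lra.
(* Up to volume [e / 2] inside the window, the countable union is a finite one. *)
have [k hk] := vol_bigcup_tail mG ndG fW e2; rewrite GU in hk.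
have [D [rD DW hD]] := (aG k).2 _ e2.
have fD := boxable_fmes rD.
have GF : G k `<=` \bigcup_i F i by rewrite -GU => x Gx; exists k.
exists D; split => //.
have f1 : fmes (W `&` (\bigcup_i F i `\` G k)) by apply: fmesIl => //; apply: mesD => //; exact: mes_bigcup.
have f2 : fmes ((G k `&` W) `\` D).
  by apply: fmesD; [apply: fmes_sub fW => [|x [] //]; apply: mesI => //; case: fW|case: fD].
have : vol ((\bigcup_i F i `&` W) `\` D) <= vol (W `&` (\bigcup_i F i `\` G k)) + vol ((G k `&` W) `\` D).
  apply: le_trans (volU_le f1 f2); apply: le_vol_outer; last exact: fmesU.
  move=> x [[Fx Wx] nD]; have [Gx|nG] := pselect (G k x); first by right.
  by left.
have : vol (D `\` \bigcup_i F i) <= vol (D `\` G k).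
  by apply: le_vol_outer; [move=> x [Dx nF]; split => // /GF|exact: fmesD].
lra.
Qed.

Lemma approximable_lt j (a : R) : mes [set x : 'rV[R]_n | x 0 j < a] -> approximable [set x | x 0 j < a].
Proof.
move=> m; split => // e e0; exists (W `&` [set x | x 0 j < a]); split.
- exact: boxable_lows.
- by move=> x [].
- rewrite setIC setDv vol0 add0r (_ : _ `\` _ = set0) ?vol0 ?ltW//.
  by apply/seteqP; split => x // [[]].
Qed.

Let utup (x : 'rV[R]_n) : n.-tuple mR := [tuple x 0 i | i < n].

Let utupK (t : n.-tuple mR) : utup (\row_i tnth t i) = t.
Proof. by apply: eq_from_tnth => i; rewrite tnth_mktuple mxE. Qed.

(** The sigma-algebra is generated in two layers: preimages under the coordinates of measurable sets
    of the line, and on the line the open rays. Half-spaces are boxable inside the window, and the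
    closure properties do the rest. *)
Lemma approximable_mes A : mes A -> approximable A.
Proof.
move=> mA.
pose P (X : set (n.-tuple mR)) := approximable [set x | X (utup x)].
suff : P (tpre A).
  rewrite /P (_ : [set x | _] = A)//; apply/seteqP; split => x;
  by rewrite /tpre/= (_ : \row_i _ = x)//; apply/rowP => i; rewrite mxE tnth_mktuple.
move: mA; rewrite /mes; move: (tpre A) => X; rewrite /measurable/=.
apply: smallest_sub.
  split => /=; rewrite /P.
  - exact: approximable0.
  - move=> B aB; rewrite (_ : [set x | _] = ~` [set x | B (utup x)]); first exact: approximableC.
    by apply/seteqP; split => x //= -[].
  - move=> F aF; rewrite (_ : [set x | _] = \bigcup_k [set x | F k (utup x)]); first exact: approximable_bigcup.
    by [].
move=> B; rewrite -bigcup_seq => -[j _ [E mE <-]]; rewrite setTI /P /=.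
rewrite (_ : [set x | _] = [set x : 'rV[R]_n | E (x 0 j)]); last first.
  by apply/seteqP; split => x /=; rewrite tnth_mktuple.
move: E mE; rewrite RGenInftyO.measurableE; apply: smallest_sub.
  split => /=.
  - exact: approximable0.
  - move=> C aC; rewrite (_ : [set x | _] = ~` [set x : 'rV[R]_n | C (x 0 j)]); first exact: approximableC.
    by apply/seteqP; split => x //= -[].
  - move=> F aF; rewrite (_ : [set x | _] = \bigcup_k [set x : 'rV[R]_n | F k (x 0 j)]); first exact: approximable_bigcup.
    by [].
move=> _ [a ->] /=.
rewrite (_ : [set x | _] = [set x : 'rV[R]_n | x 0 j < a]); last first.
  by apply/seteqP; split => x /=; rewrite in_itv/=.
apply: approximable_lt; rewrite /mes.
rewrite (_ : tpre _ = (@tnth n mR ^~ j) @^-1` `]-oo, a[%classic); last first.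
  by apply/seteqP; split => t; rewrite /tpre/= in_itv/= mxE.
by rewrite -[X in measurable X]setTI; apply: measurable_tnth => //; exact: measurable_itv.
Qed.

End fixed_window.

Lemma box_approx A (M e : R) : mes A -> 0 < M ->
  (forall x, A x -> forall i, - M <= x 0 i < M) -> 0 < e ->
  exists s, [/\ all bpos s, pairwise bsep s,
    vol (A `\` bunion s) <= e & vol (bunion s `\` A) <= e].
Proof.
move=> mA M0 AM e0.
pose Z : box := (const_mx (- M), const_mx M).
have rZ : boxable (bset Z).
  exists [:: Z]; split => //; last by rewrite /bunion big_seq1.
  by rewrite /= andbT; apply/forallP => i; rewrite !mxE; lra.
have [_ /(_ _ e0)[D [[s [ps ds <-]] _ h]]] := approximable_mes rZ mA.
have AZ : A `&` bset Z = A.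
  by apply/setIidPl => x Ax i; rewrite !mxE; exact: AM.
rewrite AZ in h.
by exists s; split => //; apply: le_trans h; rewrite ?lerDl ?lerDr vol_ge0.
Qed.

End box_approximation.

(** * Weighted AM-GM and Bernoulli inequalities *)

Section real_inequalities.
Context (R : realType).
Implicit Types (u v t x : R).

Lemma ln_prod (I : Type) (s : seq I) (F : I -> R) : (forall i, 0 < F i) ->
  ln (\prod_(i <- s) F i) = \sum_(i <- s) ln (F i).
Proof.
move=> F0; elim: s => [|i s IH]; first by rewrite !big_nil ln1.
rewrite !big_cons lnM ?posrE//; first by rewrite IH.
by rewrite prodr_gt0.
Qed.

(** Concavity of [ln], through its tangent at the mean [m]. *)
Lemma amgm_expR t u v : 0 <= t <= 1 -> 0 < u -> 0 < v ->
  expR ((1 - t) * ln u + t * ln v) <= (1 - t) * u + t * v.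
Proof.
move=> /andP[t0 t1] u0 v0; set m := (1 - t) * u + t * v.
have m0 : 0 < m.
  by rewrite /m; have [->|] := eqVneq t 0; [lra|move=> tn; have : 0 < t by [rewrite lt0r tn]; nra].
rewrite -[leRHS]lnK ?posrE// ler_expR.
have lnle w : 0 < w -> ln w <= ln m + (w / m - 1).
  move=> w0; have wm0 : 0 < w / m by rewrite divr_gt0.
  rewrite -[X in ln X](@divfK _ m) ?gt_eqF// lnM ?posrE// addrC lerD2l.
  have := @le_ln1Dx _ (w / m - 1); rewrite addrCA subrr addr0; apply; lra.
have hu := lnle _ u0; have hv := lnle _ v0.
have e : (1 - t) * (u / m) + t * (v / m) = 1.
  by rewrite !mulrA -mulrDl divff// gt_eqF.
have t1' : 0 <= 1 - t by lra.
have := ler_wpM2l t1' hu; have := ler_wpM2l t0 hv.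
rewrite !mulrDr; move: e; set p := _ * (u / m); set q := _ * (v / m).
move: (ln u) (ln v) (ln m) => *; nra.
Qed.

(** Multiplicative Brunn-Minkowski inequality for two boxes with sides [u] and [v]. *)
Lemma amgm_prod n t (u v : 'I_n -> R) : 0 <= t <= 1 ->
  (forall i, 0 < u i) -> (forall i, 0 < v i) ->
  expR ((1 - t) * ln (\prod_i u i) + t * ln (\prod_i v i)) <=
  \prod_i ((1 - t) * u i + t * v i).
Proof.
move=> t01 u0 v0; rewrite !ln_prod// !mulr_sumr -big_split /= expR_sum.
by apply: ler_prod => i _; rewrite expR_ge0 amgm_expR.
Qed.

Lemma bernoulli_sub n x : 0 <= x <= 1 -> 1 - n%:R * x <= (1 - x) ^+ n.
Proof.
move=> /andP[x0 x1]; elim: n => [|n IH]; first by rewrite mul0r subr0 expr0.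
rewrite exprS -natr1; have := @ler_wpM2l _ (1 - x) _ _ _ IH.
have : 0 <= n%:R * x ^+ 2 by rewrite mulr_ge0// exprn_ge0.
rewrite expr2; move: ((1 - x) ^+ n) (n%:R : R) => p m h1 h2.
have := h2 ltac:(lra); nra.
Qed.
End real_inequalities.

(** * Interpolation along the coupling and densities of its laws *)

Section transport.
Context (R : realType) (n : nat).
Local Notation box := ('rV[R]_n * 'rV[R]_n)%type.
Implicit Types (X Y Z : box) (s t : seq box) (l m : box * box) (T : set 'rV[R]_n).
Implicit Types (sg : 'I_n -> R).

(** Each coordinate has its own time: a constant [sg] gives a point of the segment, other choices
    the points met while coordinates are updated in turn. *)
Definition mix sg (x y : 'rV[R]_n) : 'rV[R]_n :=
  \row_j ((1 - sg j) * x 0 j + sg j * y 0 j).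

Definition lbox sg l : box := (mix sg l.1.1 l.2.1, mix sg l.1.2 l.2.2).

Definition bpt Z (th : 'rV[R]_n) : 'rV[R]_n :=
  \row_j (Z.1 0 j + (Z.2 0 j - Z.1 0 j) * th 0 j).

Definition ucube : set 'rV[R]_n := rbox (fun=> 0) (fun=> 1).

(** Coupled points of a leaf share the parameter [th], so all events along a path are compared in
    one unit cube; intersecting with the box confines [th] to that cube. *)
Definition lset sg l T : set 'rV[R]_n :=
  [set th | (T `&` bset (lbox sg l)) (bpt (lbox sg l) th)].

Lemma bpt_lbox sg l th : bpt (lbox sg l) th = mix sg (bpt l.1 th) (bpt l.2 th).
Proof. by apply/rowP => j; rewrite !mxE; ring. Qed.

Lemma mix0 x y : mix (fun=> 0) x y = x.
Proof. by apply/rowP => j; rewrite !mxE; ring. Qed.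

Lemma mix1 x y : mix (fun=> 1) x y = y.
Proof. by apply/rowP => j; rewrite !mxE; ring. Qed.

Lemma conv2_gt0 (t u v : R) : 0 <= t <= 1 -> 0 < u -> 0 < v -> 0 < (1 - t) * u + t * v.
Proof.
move=> /andP[t0 t1] u0 v0; have [->|tn] := eqVneq t 0; first by lra.
have : 0 < t by rewrite lt0r tn.
nra.
Qed.

Lemma lboxB sg l j : (lbox sg l).2 0 j - (lbox sg l).1 0 j =
  (1 - sg j) * (l.1.2 0 j - l.1.1 0 j) + sg j * (l.2.2 0 j - l.2.1 0 j).
Proof. by rewrite !mxE; ring. Qed.

Lemma bpos_lbox sg l : (forall j, 0 <= sg j <= 1) -> bpos l.1 -> bpos l.2 ->
  bpos (lbox sg l).
Proof.
move=> s01 /forallP p1 /forallP p2; apply/forallP => j.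
by rewrite -subr_gt0 lboxB conv2_gt0 ?subr_gt0.
Qed.

Lemma bpt_in Z th : bpos Z -> ucube th -> bset Z (bpt Z th).
Proof.
move=> /forallP pZ hth j; rewrite mxE; have /andP[h0 h1] := hth j.
have h := pZ j; apply/andP; split; nra.
Qed.

(* Since sources and targets are separated in the same order, all their
   interpolations, even with a different time in each coordinate, are disjoint. *)
Lemma leafsep_disjoint sg l m : (forall j, 0 <= sg j <= 1) -> leafsep l m ->
  bset (lbox sg l) `&` bset (lbox sg m) = set0.
Proof.
move=> s01 /existsP[j h]; apply: bsep_disjoint; apply/existsP; exists j.
have /andP[s0 s1] := s01 j.
rewrite !mxE; case/orP: h => /andP[h1 h2]; apply/orP; [left|right]; nra.
Qed.

Lemma fmes_lset sg l T : (forall j, 0 <= sg j <= 1) -> bpos l.1 -> bpos l.2 ->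
  fmes T -> fmes (lset sg l T).
Proof.
move=> s01 p1 p2 fT.
apply: (@fmes_affine R n (fun j => (lbox sg l).1 0 j)
  (fun j => (lbox sg l).2 0 j - (lbox sg l).1 0 j) (T `&` bset (lbox sg l))).
  by move=> j; rewrite subr_gt0; apply: (forallP (bpos_lbox s01 p1 p2)).
exact: fmesIl fT (mes_bset _).
Qed.

Lemma vol_lset sg l T : (forall j, 0 <= sg j <= 1) -> bpos l.1 -> bpos l.2 ->
  fmes T -> bvol (lbox sg l) * vol (lset sg l T) = vol (T `&` bset (lbox sg l)).
Proof.
move=> s01 p1 p2 fT.
apply: (@vol_affine R n (fun j => (lbox sg l).1 0 j)
  (fun j => (lbox sg l).2 0 j - (lbox sg l).1 0 j) (T `&` bset (lbox sg l))).
  by move=> j; rewrite subr_gt0; apply: (forallP (bpos_lbox s01 p1 p2)).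
exact: fmesIl fT (mes_bset _).
Qed.

Section coupled.
Variables (s t : seq box) (L : seq (box * box)).
Hypotheses (cL : coupling s t L) (s0 : 0 < tvol s) (t0 : 0 < tvol t).

(** The left side is the probability that the interpolated point falls in [T]: leaf [l] is drawn
    with weight [bvol l.1 / tvol s], then [th] uniformly. Interpolated leaves are disjoint, so a
    bound [D] for the density on each leaf bounds the density of the law. *)
Lemma sum_lset sg T (D : R) : (forall j, 0 <= sg j <= 1) -> fmes T -> 0 <= D ->
  (forall l, l \in L -> bvol l.1 <= tvol s * D * bvol (lbox sg l)) ->
  \sum_(l <- L) bvol l.1 / tvol s * vol (lset sg l T) <= D * vol T.
Proof.
case: cL => hL pL _ s01 fT D0 hD.
have := vol_sum_disjoint (d := leafsep) (F := fun l => bset (lbox sg l)) pL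
  (fun l m => leafsep_disjoint s01) (fun l => mes_bset _) fT.
move=> /(ler_wpM2l D0); apply: le_trans.
rewrite mulr_sumr big_seq [leRHS]big_seq; apply: ler_sum => l lL.
have [p1 p2 _ _] := hL l lL.
rewrite -vol_lset// mulrA ler_wpM2r ?vol_ge0// ler_pdivrMr//.
by apply: le_trans (hD l lL) _; rewrite le_eqVlt; apply/orP; left; apply/eqP; ring.
Qed.

Let el := ln (tvol t) - ln (tvol s).

(* AM-GM in each coordinate: the law of the interpolation at time [tau] has
   density at most the geometric mean of the densities of source and target. *)
Lemma bvol_lbox_cst (tau : R) l : 0 <= tau <= 1 -> l \in L ->
  bvol l.1 <= tvol s * (tvol s * expR (tau * el))^-1 * bvol (lbox (fun=> tau) l).
Proof.
case: cL => hL _ _ tau01 /hL[p1 p2 e _].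
have h1 := bvol_gt0 p1; have h2 := bvol_gt0 p2.
rewrite invfM mulrA divff ?gt_eqF// mul1r mulrC ler_pdivlMr ?expR_gt0//.
have := amgm_prod tau01 (fun i => _ : 0 < l.1.2 0 i - l.1.1 0 i) (fun i => _ : 0 < l.2.2 0 i - l.2.1 0 i).
move=> /(_ (fun i => ltac:(rewrite subr_gt0; exact: (forallP p1 i)))).
move=> /(_ (fun i => ltac:(rewrite subr_gt0; exact: (forallP p2 i)))).
rewrite -/(bvol l.1) -/(bvol l.2).
under [X in _ <= X -> _]eq_bigr do rewrite -(lboxB (fun=> tau)).
rewrite -/(bvol (lbox (fun=> tau) l)); apply: le_trans.
have le : ln (bvol l.2) = ln (bvol l.1) + el.
  have := congr1 (@ln R) e; rewrite !lnM ?posrE// /el; lra.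
rewrite le (_ : (1 - tau) * _ + _ = ln (bvol l.1) + tau * el); last by ring.
by rewrite expRD lnK ?posrE.
Qed.

(** At the common time [tau] a leaf is at least as large as its source, because [el >= 0]. Advancing
    some coordinates by [h] shrinks each side at most by the factor [1 - 2 h], and
    [(1 - 2 h) ^ n >= 1 / 2]. *)
Lemma bvol_lbox_hyb (tau h : R) sg l : 0 <= tau -> tau + h <= 2^-1 -> 0 <= h ->
  4 * n%:R * h <= 1 -> 0 <= el ->
  (forall j, sg j = tau \/ sg j = tau + h) -> l \in L ->
  bvol l.1 <= tvol s * (2 / tvol s) * bvol (lbox sg l).
Proof.
move=> tau0 tauh h0 nh el0 hsg lL.
have tau01 : 0 <= tau <= 1 by apply/andP; split; lra.
rewrite (_ : tvol s * (2 / tvol s) = 2); last by rewrite mulrC divfK ?gt_eqF.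
have := bvol_lbox_cst tau01 lL.
have [p1 p2 _ _] := let: And3 hL _ _ := cL in hL l lL.
rewrite invfM !mulrA divff ?gt_eqF// mul1r.
move=> H.
have B0 : 0 < bvol (lbox (fun=> tau) l) by apply: bvol_gt0; apply: bpos_lbox.
have {}H : bvol l.1 <= bvol (lbox (fun=> tau) l).
  apply: le_trans H _; rewrite ger_pMl// invf_le1 ?expR_gt0//.
  by rewrite -expR0 ler_expR mulr_ge0.
apply: le_trans H _.
(* With [u] and [v] the sides of source and target, the loss [h u] is at most [2 h] times the side
   at time [tau], since [1 - tau >= 1 / 2]. This is why times are kept below [1 / 2]. *)
have hh : (1 - 2 * h) ^+ n * bvol (lbox (fun=> tau) l) <= bvol (lbox sg l).
  rewrite /bvol -[X in X ^+ _]/(1 - 2 * h) -{1}(card_ord n) -prodr_const -big_split /=.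
  apply: ler_prod => j _; rewrite !lboxB.
  have /forallP/(_ j) := p1; have /forallP/(_ j) := p2.
  rewrite -subr_gt0 => q2; rewrite -subr_gt0 => q1.
  have h2 : 0 <= 1 - 2 * h by lra.
  have c0 : 0 < (1 - tau) * (l.1.2 0 j - l.1.1 0 j) + tau * (l.2.2 0 j - l.2.1 0 j) by exact: conv2_gt0.
  apply/andP; split; first by rewrite mulr_ge0// ltW.
  move: q1 q2 c0; set u := _ - l.1.1 0 j; set v := _ - l.2.1 0 j => q1 q2 c0.
  have hu : 0 <= h * u by rewrite mulr_ge0// ltW.
  have hv : 0 <= h * v by rewrite mulr_ge0// ltW.
  have htu : 0 <= (1 - 2 * tau) * (h * u) by rewrite mulr_ge0//; lra.
  have htv : 0 <= tau * (h * v) by rewrite mulr_ge0.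
  by case: (hsg j) => ->; nra.
have b : 2^-1 <= (1 - 2 * h) ^+ n.
  apply: le_trans (bernoulli_sub n _); first by lra.
  apply/andP; split; first lra.
  lra.
have : 2^-1 * bvol (lbox (fun=> tau) l) <= bvol (lbox sg l).
  by apply: le_trans hh; rewrite ler_wpM2r// ltW.
lra.
Qed.

End coupled.

(* The [k]-th of [N] steps from time [0] to time [tau], halted after the
   coordinates up to [i] have been updated. *)
Definition stair (tau : R) (N : nat) (k : 'I_N) (i : 'I_n) : 'I_n -> R :=
  fun j => if (j <= i)%N then tau * (k.+1%:R / N%:R) else tau * (k%:R / N%:R).

Lemma stairP (tau : R) N (k : 'I_N) i j :
  stair tau k i j = tau * (k%:R / N%:R) \/
  stair tau k i j = tau * (k%:R / N%:R) + tau / N%:R.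
Proof.
rewrite /stair; case: ifP => _; [right|by left].
by rewrite -natr1 mulrDl mulrDr mul1r.
Qed.

Lemma vol_ucube : vol ucube = 1.
Proof. by rewrite vol_rbox => [|i]; rewrite ?ler01// big1// => i _; rewrite subr0. Qed.

(** The four terms bound the probabilities that a coupled pair starts outside [S0], ends outside
    [K0], is in [S0] at time [tau], or meets [M] at one of the [N * n] halts. By the last hypothesis
    one of these occurs, so in each leaf the parameter cube, of volume 1, is covered. *)
Lemma transport_ineq s t (S0 K0 M : set 'rV[R]_n) (tau : R) (N : nat) :
  all bpos s -> all bpos t -> pairwise bsep s -> pairwise bsep t ->
  0 < tvol s -> 0 < tvol t -> tvol s <= tvol t ->
  fmes S0 -> fmes K0 -> fmes M -> 0 <= tau <= 2^-1 -> (0 < N)%N ->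
  4 * n%:R * (tau / N%:R) <= 1 ->
  (forall x z, S0 x -> K0 z -> ~ S0 (mix (fun=> tau) x z) ->
     exists k : 'I_N, exists i : 'I_n, M (mix (stair tau k i) x z)) ->
  1 <= vol (bunion s `\` S0) / tvol s + vol (bunion t `\` K0) / tvol t +
       vol S0 / (tvol s * expR (tau * (ln (tvol t) - ln (tvol s)))) +
       N%:R * n%:R * (2 / tvol s) * vol M.
Proof.
move=> ps pt ds dt s0 t0 st fS fK fM /andP[tau0 tau2] N0 nh path.
have nonempty (u : seq box) : 0 < tvol u -> (0 < size u)%N.
  by case: u => //; rewrite /tvol big_nil ltxx.
have [L cL] := coupling_exists ps pt ds dt (nonempty _ s0) (nonempty _ t0).
have [hL pL sL] := cL.
have el0 : 0 <= ln (tvol t) - ln (tvol s) by rewrite subr_ge0 ler_ln ?posrE.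
have N0' : 0 < N%:R :> R by rewrite ltr0n.
have h0 : 0 <= tau / N%:R by rewrite divr_ge0// ltW.
have tk0 (k : nat) : 0 <= tau * (k%:R / N%:R) by rewrite mulr_ge0// divr_ge0// ltW.
have tkh (k : 'I_N) : tau * (k%:R / N%:R) + tau / N%:R <= 2^-1.
  have -> : tau * (k%:R / N%:R) + tau / N%:R = tau * (k.+1%:R / N%:R).
    by rewrite -natr1 mulrDl mulrDr mul1r.
  apply: le_trans tau2; rewrite ler_piMr// ler_pdivrMr// mul1r ler_nat; exact: ltn_ord.
have stair01 (k : 'I_N) i j : 0 <= stair tau k i j <= 1.
  by have := tk0 k; have := tkh k; case: (stairP tau k i j) => ->; move=> ? ?; apply/andP; split; lra.
have tau01 : 0 <= tau <= 1 by apply/andP; split; lra.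
have fsS : fmes (bunion s `\` S0) by apply: fmesD; [exact: fmes_bunion|case: fS].
have ftK : fmes (bunion t `\` K0) by apply: fmesD; [exact: fmes_bunion|case: fK].
have c0 : forall j : 'I_n, 0 <= (0 : R) <= 1 by move=> _; rewrite lexx ler01.
have c1 : forall j : 'I_n, 0 <= (1 : R) <= 1 by move=> _; rewrite lexx ler01.
have ct : forall j : 'I_n, 0 <= tau <= 1 by [].
pose w (l : box * box) := bvol l.1 / tvol s.
pose I := ('I_N * 'I_n)%type.
pose E (l : box * box) (q : I) := lset (stair tau q.1 q.2) l M.
have cover l : l \in L -> 1 <= vol (lset (fun=> 0) l (bunion s `\` S0)) +
    vol (lset (fun=> 1) l (bunion t `\` K0)) + vol (lset (fun=> tau) l S0) +
    \sum_(q : I) vol (E l q).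
  move=> lL; have [p1 p2 _ /andP[hs ht]] := hL l lL.
  have f1 := fmes_lset c0 p1 p2 fsS; have f2 := fmes_lset c1 p1 p2 ftK.
  have f3 := fmes_lset ct p1 p2 fS.
  have f4 q : fmes (E l q) := fmes_lset (stair01 _ _) p1 p2 fM.
  rewrite -[leLHS]vol_ucube.
  apply: (@le_trans _ _ (vol (lset (fun=> 0) l (bunion s `\` S0) `|`
    lset (fun=> 1) l (bunion t `\` K0) `|` lset (fun=> tau) l S0 `|`
    \big[setU/set0]_(q : I) E l q))); last first.
    apply: le_trans (volU_le _ _) _; [by do 2?apply: fmesU|exact: fmes_big_setU|].
    apply: lerD; last exact: vol_big_setU_le.
    apply: le_trans (volU_le _ _) _; [exact: fmesU|by []|].
    by rewrite lerD2r; apply: volU_le.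
  apply: le_vol_outer; last first.
    by apply: fmesU; [do 2?apply: fmesU|exact: fmes_big_setU].
  move=> th hth.
  have inb sg : (forall j, 0 <= sg j <= 1) -> bset (lbox sg l) (bpt (lbox sg l) th).
    by move=> s01; apply: bpt_in hth; exact: bpos_lbox.
  have sub X Y x : bsub X Y -> bset X x -> bset Y x.
    move=> /forallP XY Xx j; have /andP[h1 h2] := XY j; have /andP[h3 h4] := Xx j.
    by rewrite (le_trans h1 h3) (lt_le_trans h4 h2).
  set x := bpt l.1 th; set z := bpt l.2 th.
  have sx : bunion s x.
    have /hasP[Z Zs lZ] := hs; apply/bunionP; exists Z => //; apply: sub lZ _.
    exact: bpt_in.
  have tz : bunion t z.
    have /hasP[Z Zs lZ] := ht; apply/bunionP; exists Z => //; apply: sub lZ _.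
    exact: bpt_in.
  have [Sx|nSx] := pselect (S0 x); last first.
    by left; left; left; split; [rewrite bpt_lbox mix0|exact: inb].
  have [Kz|nKz] := pselect (K0 z); last first.
    by left; left; right; split; [rewrite bpt_lbox mix1|exact: inb].
  have [Sp|nSp] := pselect (S0 (mix (fun=> tau) x z)).
    by left; right; split; [rewrite bpt_lbox|exact: inb].
  have [k [i Mki]] := path _ _ Sx Kz nSp.
  right; rewrite -bigcup_seq; exists (k, i); first exact: mem_index_enum.
  by split; [rewrite bpt_lbox|exact: inb (stair01 _ _)].
have w0 l : l \in L -> 0 <= w l.
  by move=> /hL[p1 _ _ _]; rewrite divr_ge0 ?ltW// bvol_gt0.
have : \sum_(l <- L) w l * 1 <= \sum_(l <- L) w l *
   (vol (lset (fun=> 0) l (bunion s `\` S0)) +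
    vol (lset (fun=> 1) l (bunion t `\` K0)) + vol (lset (fun=> tau) l S0) +
    \sum_(q : I) vol (E l q)).
  rewrite big_seq [leRHS]big_seq; apply: ler_sum => l lL.
  by rewrite ler_wpM2l ?w0// cover.
under eq_bigr do rewrite mulr1.
rewrite -mulr_suml sL divff ?gt_eqF//.
under [X in _ <= X -> _]eq_bigr do rewrite !mulrDr mulr_sumr.
rewrite !big_split /= exchange_big /=; move/le_trans; apply.
apply: lerD; first apply: lerD; first apply: lerD.
- rewrite mulrC; apply: (sum_lset cL) => //; first by rewrite invr_ge0 ltW.
  move=> l lL; rewrite divff ?gt_eqF// mul1r le_eqVlt; apply/orP; left; apply/eqP.
  by rewrite /lbox !mix0; case: (l.1).
- rewrite mulrC; apply: (sum_lset cL) => //; first by rewrite invr_ge0 ltW.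
  move=> l lL; have [_ _ e _] := hL l lL.
  rewrite /lbox !mix1 -surjective_pairing mulrAC ler_pdivlMr//.
  by rewrite e mulrC.
- rewrite mulrC; apply: (sum_lset cL) => //; first by rewrite invr_ge0 mulr_ge0 ?expR_ge0// ltW.
  by move=> l lL; exact: (bvol_lbox_cst cL).
- apply: (@le_trans _ _ (\sum_(q : I) 2 / tvol s * vol M)).
    apply: ler_sum => q _; apply: (sum_lset cL) => //.
      by rewrite divr_ge0// ltW.
    move=> l lL; apply: (bvol_lbox_hyb cL _ _ (tk0 q.1) (tkh q.1)) => //.
    exact: stairP.
  by rewrite sumr_const card_prod !card_ord -[leLHS]mulr_natl natrM mulrA.
Qed.

End transport.

(** * Unconditional bodies, depth, and coordinatewise moves *)

Section convexity.
Context (R : realType) (n : nat).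
Implicit Types (A K Q S M : set 'rV[R]_n) (x y z q : 'rV[R]_n).

Definition cvx A := forall x y (t : R), A x -> A y -> 0 <= t <= 1 ->
  A ((1 - t) *: x + t *: y).

Lemma convex_set_cvx A : convex_set A -> cvx A.
Proof.
move=> cA x y t Ax Ay /andP[t0 t1].
have s0 : 0 <= 1 - t by rewrite subr_ge0.
have s1 : 1 - t <= 1 by rewrite gerBl.
have := cA x y (Itv01 s0 s1) (mem_set Ax) (mem_set Ay).
rewrite inE; congr (A _); rewrite /conv/=; congr (_ + _ *: _).
exact: subKr.
Qed.

Definition coord_restrict (P : pred 'I_n) q : 'rV[R]_n := \row_j (if P j then q 0 j else 0).

Definition hybrid (P : pred 'I_n) x y : 'rV[R]_n :=
  \row_j (if P j then y 0 j else x 0 j).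

Lemma hybridE P x y : hybrid P x y = x + coord_restrict P (y - x).
Proof. by apply/rowP => j; rewrite !mxE; case: ifP => _; rewrite ?addr0// addrCA subrr addr0. Qed.

Lemma coord_restrictZ P (a : R) q : coord_restrict P (a *: q) = a *: coord_restrict P q.
Proof. by apply/rowP => j; rewrite !mxE; case: ifP => _; rewrite ?mulr0. Qed.

(** The first partial update outside [S] differs in one coordinate from the previous one, which lies
    in [S]. *)
Lemma crossing K S x y : S x -> ~ S y -> (forall P, K (hybrid P x y)) ->
  exists i : 'I_n, boundary0 K S (hybrid (fun j => (j <= i)%N) x y).
Proof.
move=> Sx nSy hK; apply: contrapT => hno.
have H m : (m <= n)%N -> S (hybrid (fun j => (j < m)%N) x y).
  elim: m => [_|m IH mn].
    by rewrite (_ : hybrid _ _ _ = x)//; apply/rowP => j; rewrite mxE.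
  have Sm := IH (ltnW mn); apply: contrapT => nS; apply: hno.
  (* Updating the indices [j <= m] is the update of [m + 1] coordinates that has just left [S]. *)
  exists (Ordinal mn); split; first by split; [exact: hK|exact: nS].
  exists (hybrid (fun j => (j < m)%N) x y) => //.
  rewrite -[X in (_ <= X)%N](card1 (Ordinal mn)); apply: subset_leq_card.
  apply/fintype.subsetP => j; rewrite !inE !mxE /= -val_eqE /=.
  by case: (ltngtP j m) => // _; rewrite eqxx.
apply: nSy; have := H n (leqnn n); rewrite (_ : hybrid _ _ _ = y)//.
by apply/rowP => j; rewrite mxE ltn_ord.
Qed.

Section unconditional_body.
Variable Q : set 'rV[R]_n.
Hypotheses (cQ : cvx Q) (uQ : unconditional Q) (nQ : Q !=set0).

(** The restriction is the midpoint of [q] and its reflection in the coordinates outside [P]. *)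
Lemma unc_restrict P q : Q q -> Q (coord_restrict P q).
Proof.
move=> Qq; pose eps j : R := if P j then 1 else -1.
have e1 j : eps j = 1 \/ eps j = -1 by rewrite /eps; case: ifP; [left|right].
have Qe := uQ e1 Qq.
have := cQ (t := 2^-1) Qq Qe; rewrite (_ : _ *: _ + _ *: _ = coord_restrict P q).
  by apply; apply/andP; split; lra.
apply/rowP => j; rewrite !mxE /eps; case: ifP => _; lra.
Qed.

Lemma unc0 : Q 0.
Proof.
have [q Qq] := nQ; have := unc_restrict xpred0 Qq.
by congr Q; apply/rowP => j; rewrite !mxE.
Qed.

Lemma uncN q : Q q -> Q (- q).
Proof.
move=> Qq; have := uQ (eps := fun=> -1) (fun=> or_intror erefl) Qq.
by congr Q; apply/rowP => j; rewrite !mxE mulN1r.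
Qed.

Lemma uncZ (a : R) q : 0 <= a <= 1 -> Q q -> Q (a *: q).
Proof. by move=> a01 Qq; have := cQ unc0 Qq a01; rewrite scaler0 add0r. Qed.

Variables (K : set 'rV[R]_n) (x0 y0 : 'rV[R]_n) (r Rad : R).
Hypotheses (cK : cvx K) (r0 : 0 < r) (R0 : 0 < Rad).
Hypothesis inK : forall q, Q q -> K (x0 + r *: q).
Hypothesis outK : forall x, K x -> exists2 q, Q q & x = y0 + Rad *: q.

Lemma center_in : K x0.
Proof. by have := inK unc0; rewrite scaler0 addr0. Qed.

Lemma diff_in x z : K x -> K z -> exists2 q, Q q & z - x = (2 * Rad) *: q.
Proof.
move=> /outK[p Qp ->] /outK[q Qq ->].
have := cQ (t := 2^-1) Qq (uncN Qp) ltac:(apply/andP; split; lra).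
set u := _ + _ => Qu; exists u => //; apply/rowP => j; rewrite !mxE; lra.
Qed.

(** Depth is measured by dilation towards [x0] and not by distance: volumes of cores are then
    explicit, and moves along [Q] consume depth linearly. *)
Definition core (d : R) : set 'rV[R]_n :=
  [set x | exists2 k, K k & x = (1 - d) *: k + d *: x0].

Lemma core0 : core 0 = K.
Proof.
apply/seteqP; split => x.
  by move=> [k Kk ->]; rewrite subr0 scale1r scale0r addr0.
by move=> Kx; exists x => //; rewrite subr0 scale1r scale0r addr0.
Qed.

Lemma core_mono d e : 0 <= d -> d <= e -> e <= 1 -> core e `<=` core d.
Proof.
move=> d0; rewrite le_eqVlt => /orP[/eqP <- _ x //|de e1 x [k Kk ->]].
have d1 : 0 < 1 - d by lra.
pose t := (e - d) / (1 - d).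
have t01 : 0 <= t <= 1.
  by rewrite /t divr_ge0 ?ler_pdivrMr//=; lra.
exists ((1 - t) *: k + t *: x0); first exact: cK center_in t01.
have td : t * (1 - d) = e - d by rewrite divfK ?gt_eqF.
have {}td : e = d + t * (1 - d) by rewrite td addrC subrK.
by apply/rowP => j; rewrite !mxE [in LHS]td; ring.
Qed.

Lemma core_sub d : 0 <= d <= 1 -> core d `<=` K.
Proof. by move=> /andP[d0 d1]; rewrite -[X in _ `<=` X]core0; exact: core_mono. Qed.

Lemma core_convex d x z t : core d x -> core d z -> 0 <= t <= 1 ->
  core d ((1 - t) *: x + t *: z).
Proof.
move=> [k Kk ->] [l Kl ->] t01; exists ((1 - t) *: k + t *: l); first exact: cK.
by apply/rowP => j; rewrite !mxE; ring.
Qed.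

(** A fraction [kap] of the depth is spent: with [x = (1 - d) k + d x0], the share [kap d] of [x0]
    is replaced by the point [x0 + r q] of [K]. *)
Lemma core_move d kap x q : 0 <= d -> d < 1 -> 0 <= kap <= 1 -> core d x -> Q q ->
  core ((1 - kap) * d) (x + (kap * d * r) *: q).
Proof.
move=> d0 d1 /andP[k0 k1] [k Kk ->] Qq.
pose e := (1 - kap) * d; have ed : e <= d by rewrite /e; nra.
have e1 : 0 < 1 - e by lra.
pose t := (d - e) / (1 - e).
have t01 : 0 <= t <= 1.
  by rewrite /t divr_ge0 ?ler_pdivrMr//=; lra.
exists ((1 - t) *: k + t *: (x0 + r *: q)); first exact: cK (inK Qq) t01.
have td : t * (1 - e) = d - e by rewrite divfK ?gt_eqF.
apply/rowP => j; rewrite !mxE -/e.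
rewrite (_ : kap * d = t * (1 - e)); last by rewrite td /e; ring.
have {}td : d = e + t * (1 - e) by rewrite td addrC subrK.
rewrite [in LHS]td; ring.
Qed.

(** The opposite move, along [- q], starting from depth [D]. It limits how much deeper a move can
    lead. *)
Lemma core_move_back d kap D x q : 0 <= d -> 0 <= kap -> kap * d <= D -> 0 < D -> D < 1 ->
  Q q -> core D (x + (kap * d * r) *: q) -> core (D - kap * d) x.
Proof.
move=> d0 k0 kD D0 D1 Qq cx.
have kap01 : 0 <= kap * d / D <= 1.
  by rewrite divr_ge0 ?mulr_ge0 ?(ltW D0)//= ler_pdivrMr// mul1r.
have := core_move (ltW D0) D1 kap01 cx (uncN Qq).
rewrite divfK ?gt_eqF// mulrBl divfK ?gt_eqF// mul1r; congr core.
by apply/rowP => j; rewrite !mxE; ring.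
Qed.

Lemma core_dilate d t x : core d x -> core (d + t * (1 - d)) ((1 - t) *: x + t *: x0).
Proof.
move=> [k Kk ->]; exists k => //; apply/rowP => j; rewrite !mxE; ring.
Qed.

Lemma core_dilate_back D t x : t < 1 -> core D ((1 - t) *: x + t *: x0) ->
  core ((D - t) / (1 - t)) x.
Proof.
move=> t1 [k Kk e]; exists k => //.
have t1' : 1 - t != 0 by rewrite gt_eqF// subr_gt0.
apply: (scalerI t1'); rewrite scalerDr !scalerA.
have -> : (1 - t) * (1 - (D - t) / (1 - t)) = 1 - D by field.
have -> : (1 - t) * ((D - t) / (1 - t)) = D - t by field.
apply/rowP => j; have := congr1 (fun m : 'rV[R]_n => m 0 j) e; rewrite !mxE => h.
by apply: (addIr (t * x0 0 j)); rewrite h; ring.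
Qed.

Lemma core_hybrid d kap x y q P : 0 <= d -> d < 1 -> 0 <= kap <= 1 -> core d x -> Q q ->
  y - x = (kap * d * r) *: q -> core ((1 - kap) * d) (hybrid P x y).
Proof.
move=> d0 d1 k01 cx Qq e.
by rewrite hybridE e coord_restrictZ; apply: core_move => //; exact: unc_restrict.
Qed.

Lemma core_affine d : d < 1 ->
  core d = [set x | K (\row_i (- (d / (1 - d) * x0 0 i) + (1 - d)^-1 * x 0 i))].
Proof.
move=> d1; have d1' : 1 - d != 0 by rewrite gt_eqF// subr_gt0.
apply/seteqP; split => x /=.
  move=> [k Kk ->]; rewrite (_ : \row_i _ = k)//.
  by apply/rowP => j; rewrite !mxE; field.
move=> Kx; eexists; first exact: Kx.
by apply/rowP => j; rewrite !mxE; field.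
Qed.

Lemma fmes_core d : d < 1 -> fmes K -> fmes (core d).
Proof.
move=> d1 fK; rewrite core_affine//; apply: fmes_affine fK => i.
by rewrite invr_gt0 subr_gt0.
Qed.

Lemma vol_core d : d < 1 -> fmes K -> vol (core d) = (1 - d) ^+ n * vol K.
Proof.
move=> d1 fK; have d1' : 1 - d != 0 by rewrite gt_eqF// subr_gt0.
rewrite -(@vol_affine _ _ (fun i => - (d / (1 - d) * x0 0 i)) (fun=> (1 - d)^-1) _ _ fK).
  rewrite -core_affine// prodr_const card_ord mulrA -exprMn divff// expr1n mul1r//.
by move=> i; rewrite invr_gt0 subr_gt0.
Qed.

Lemma vol_core_compl d : 0 <= d < 1 -> fmes K -> vol (K `\` core d) <= n%:R * d * vol K.
Proof.
move=> /andP[d0 d1] fK; have fc := fmes_core d1 fK.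
have := volDI fK fc.1; rewrite (_ : K `&` core d = core d); last first.
  by apply/setIidPr; apply: core_sub; rewrite d0 ltW.
rewrite (vol_core d1 fK) => e.
have := @bernoulli_sub _ n d; rewrite d0 (ltW d1) => /(_ isT) h.
have := ler_wpM2r (vol_ge0 K) h; rewrite mulrBl mul1r; lra.
Qed.

End unconditional_body.

(** Widths are compared in one coordinate: subtracting the inclusions for [q] and [- q] removes the
    centres, and the width of [Q] is positive because it has interior. *)
Lemma radius_le Q K x0 y0 (r Rad : R) : (0 < n)%N -> 0 < r -> 0 < Rad ->
  compact Q -> Q° !=set0 -> cvx Q -> unconditional Q ->
  (forall q, Q q -> K (x0 + r *: q)) ->
  (forall x, K x -> exists2 q, Q q & x = y0 + Rad *: q) -> r <= Rad.
Proof.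
move=> n0 r0 R0 kQ [q0 iq0] cQ uQ inK outK.
pose i : 'I_n := Ordinal n0.
pose V := [set q 0 i | q in Q].
have Qq0 : Q q0 by exact: interior_subset.
have nQ : Q !=set0 by exists q0.
have [B QB] : exists B, forall q, Q q -> q 0 i <= B.
  have [N [_ QN]] := compact_bounded kQ.
  exists (`|N| + 1) => q Qq; apply: le_trans (ler_norm _) _.
  apply: le_trans (QN (`|N| + 1) _ q Qq); last by rewrite (le_lt_trans (ler_norm _))// ltrDl.
  by rewrite [leRHS]/Num.Def.normr/= mx_normrE; apply/bigmax_geP; right => /=; exists (0, i).
have [p Qp pi0] : exists2 p, Q p & 0 < p 0 i.
  have : exists2 p, Q p & p 0 i != 0.
    have [e0|e0] := eqVneq (q0 0 i) 0; last by exists q0.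
    have /nbhs_ballP[e /= e_gt0 he] := iq0.
    exists (q0 + (e / 2) *: delta_mx 0 i).
      apply: he; split => // a b; rewrite ord1 -ball_normE /= !mxE eqxx /=.
      rewrite opprD addrA subrr add0r normrN; case: eqP => _; rewrite ?mulr1 ?mulr0 ?normr0//.
      by rewrite gtr0_norm; lra.
    rewrite !mxE e0 add0r !eqxx mulr1 gt_eqF//; lra.
  move=> [p Qp]; rewrite neq_lt => /orP[pn|pp]; last by exists p.
  by exists (- p); [exact: uncN|rewrite mxE oppr_gt0].
have hsup : has_sup V.
  split; first by exists (p 0 i); exists p.
  by exists B => _ [q Qq <-]; exact: QB.
have Vs q : Q q -> q 0 i <= sup V by move=> Qq; apply: ub_le_sup; [case: hsup|exists q].
have key q : Q q -> r * q 0 i <= Rad * sup V.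
  move=> Qq; have [u Qu eu] := outK _ (inK _ Qq).
  have [v Qv ev] := outK _ (inK _ (uncN uQ Qq)).
  have := congr1 (fun m : 'rV[R]_n => m 0 i) eu; have := congr1 (fun m : 'rV[R]_n => m 0 i) ev.
  rewrite !mxE; have := ler_wpM2l (ltW R0) (Vs _ Qu).
  have := ler_wpM2l (ltW R0) (Vs _ (uncN uQ Qv)); rewrite !mxE; nra.
have s0 : 0 < sup V by apply: lt_le_trans pi0 (Vs _ Qp).
have : sup V <= Rad * sup V / r.
  apply: sup_le_ub; first by case: hsup.
  by move=> _ [q Qq <-]; rewrite ler_pdivlMr// mulrC key.
by rewrite ler_pdivlMr// mulrC ler_pM2r.
Qed.

End convexity.

(** * Numerical bookkeeping for the deep case *)

Section numeric_inner.
Context (R : realType).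
Implicit Types (a b u v w : R).

Lemma ln_le_subr1 w : 0 < w -> ln w <= w - 1.
Proof.
by move=> w0; have := @le_ln1Dx _ (w - 1); rewrite addrCA subrr addr0; apply; lra.
Qed.

(** Here [u] and [v] stand for [vol S] and [vol K], [a] and [b] for their box approximations. The
    loss in the logarithm is at most [1/40 + 1/9], while [- ln (u / v) >= 1/2]. *)
Lemma log_ratio_bound a b u v : 0 < a -> 0 < b -> 0 < u -> 0 < v ->
  a <= 41 / 40 * u -> 9 / 10 * v <= b -> u <= v / 2 ->
  1 / 3 <= ln b - ln a /\ (1 - ln (u / v)) / 5 <= ln b - ln a.
Proof.
move=> a0 b0 u0 v0 au vb uv.
have uv0 : 0 < u / v by rewrite divr_gt0.
have lam2 : 1 / 2 <= - ln (u / v).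
  have h := ln_le_subr1 uv0; have : u / v <= 1 / 2.
    by rewrite ler_pdivrMr//; lra.
  lra.
have p1 : (0 : R) < 41 / 40 by lra.
have p2 : (0 : R) < 9 / 10 by lra.
have h1 : ln a <= ln (41 / 40 * u) by rewrite ler_ln ?posrE// mulr_gt0.
have h2 : ln (9 / 10 * v) <= ln b by rewrite ler_ln ?posrE// mulr_gt0.
move: h1 h2; rewrite (lnM p1 u0) (lnM p2 v0).
have q1 := ln_le_subr1 p1.
have q2 : ln (9 / 10) = - ln (10 / 9) :> R.
  by rewrite -lnV ?posrE ?invf_div//; lra.
have q3 : ln (10 / 9) <= 10 / 9 - 1 :> R by apply: ln_le_subr1; lra.
move: lam2; rewrite ln_div ?posrE// q2.
by move: q1 q3; clear => *; split; lra.
Qed.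

(** Take [tau = min (1/2) (1 / el)] and about [tau / t] steps. The bound [1/6] is [1/2 * 1/3], and
    [tau * el <= 1] bounds the number of steps. *)
Lemma step_count (el t : R) : 1 / 3 <= el -> 0 < t ->
  exists tau : R, exists N : nat, [/\ 0 <= tau <= 2^-1, 1 / 6 <= tau * el, (0 < N)%N,
    tau / N%:R <= t & N%:R * (el * t) <= 1 + el * t].
Proof.
move=> el3 t0; have el0 : 0 < el by lra.
pose tau := Num.min 2^-1 el^-1.
have tau0 : 0 < tau by rewrite lt_min !invr_gt0 el0 ltr0n.
have tau2 : tau <= 2^-1 by rewrite ge_min lexx.
have tau_el : tau <= el^-1 by rewrite ge_min lexx orbT.
have te : 1 / 6 <= tau * el.
  rewrite /tau; have [h|h] := leP 2^-1 el^-1; first by lra.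
  by rewrite mulVf ?gt_eqF//; lra.
pose N := (Num.truncn (tau / t)).+1; exists tau, N.
have N1 : tau / t < N%:R by exact: truncnS_gt.
have N2 : N%:R <= tau / t + 1.
  by rewrite -natr1 lerD2r truncn_le// divr_ge0// ltW.
have N0' : 0 < N%:R :> R by rewrite ltr0n.
split => //; first by rewrite ltW.
  by rewrite ler_pdivrMr// mulrC -ler_pdivrMr// ltW.
have X0 : 0 < el * t by rewrite mulr_gt0.
have : N%:R * (el * t) <= (tau / t + 1) * (el * t) by rewrite ler_pM2r.
move/le_trans; apply; rewrite mulrDl mul1r lerD2r.
rewrite (_ : tau / t * (el * t) = tau * el); last by field; rewrite gt_eqF.
by rewrite -ler_pdivlMr// div1r.
Qed.

(** Up to constants [1 / N] is at least [min 1 X], with [X = el * t]. The quantity [g * m] of the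
    proof is at most [X] and at most [1], so [N * (g * m) <= 2] both for long paths ([X <= 1]) and
    for short ones. *)
Lemma inner_arith (N n : nat) (delta ratio el lam sig M C : R) :
  (0 < n)%N -> 0 < delta <= 20^-1 -> 0 < ratio <= 1 -> 0 < el -> 0 <= lam -> 0 <= M -> 0 <= C ->
  lam / 5 <= el ->
  let t := delta / n%:R * ratio / 2 in
  N%:R * (el * t) <= 1 + el * t ->
  sig <= C * (N%:R * n%:R) * M ->
  delta * ratio / n%:R * Num.min 1 (lam / n%:R) * sig <= 20 * C * M.
Proof.
move=> n0 /andP[del0 del1] /andP[ra0 ra1] el0 lam0 M0 C0 hel t NX hsig.
have n0' : 0 < n%:R :> R by rewrite ltr0n.
have N0 : 0 <= N%:R :> R by exact: ler0n.
pose X := el * t; rewrite -/X in NX.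
have X0 : 0 < X by rewrite /X /t !mulr_gt0 ?invr_gt0.
pose m := Num.min 1 (lam / n%:R).
have m0 : 0 <= m by rewrite le_min ler01 divr_ge0 ?ler0n.
have m1 : m <= 1 by rewrite ge_min lexx.
have mL : m <= lam / n%:R by rewrite ge_min lexx orbT.
pose g := delta * ratio / 10.
have g0 : 0 < g by rewrite !mulr_gt0 ?invr_gt0.
have g1 : g <= 1.
  have : delta * ratio <= 20^-1 * 1 by rewrite ler_pM// ltW.
  rewrite /g; lra.
have gX : g * m <= X.
  have -> : X = g * (5 * el / n%:R) by rewrite /X /t /g; field; rewrite gt_eqF.
  rewrite ler_pM2l//; apply: le_trans mL _.
  by rewrite ler_pM2r ?invr_gt0//; lra.
have gm0 : 0 <= g * m by rewrite mulr_ge0// ltW.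
have Ngm : N%:R * (g * m) <= 2.
  have gm1 : g * m <= 1 by rewrite -[leRHS]mulr1 ler_pM// ltW.
  have [X1|X1] := leP X 1.
    have : N%:R * (g * m) <= N%:R * X by rewrite ler_wpM2l.
    lra.
  have NX' : N%:R <= (1 + X) / X by rewrite ler_pdivlMr.
  have : (1 + X) / X <= 2 by rewrite ler_pdivrMr//; lra.
  have : N%:R * (g * m) <= N%:R * 1 by rewrite ler_wpM2l.
  lra.
have e : delta * ratio / n%:R * m * sig = 10 * (g * m) * sig / n%:R.
  by rewrite /g; field; rewrite gt_eqF.
rewrite -/m e ler_pdivrMr//.
have gm8 : 0 <= 10 * (g * m) by rewrite mulr_ge0.
move: hsig => /(ler_wpM2l gm8)/le_trans; apply.
rewrite (_ : 10 * (g * m) * _ = 10 * C * (n%:R * M) * (N%:R * (g * m))); last by ring.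
have nM : 0 <= 10 * C * (n%:R * M) by rewrite !mulr_ge0// ltW.
apply: le_trans (ler_wpM2l nM Ngm) _.
by rewrite le_eqVlt; apply/orP; left; apply/eqP; ring.
Qed.

End numeric_inner.

Lemma box_approx_ratio (R : realType) n (A : set 'rV[R]_n) (B : R) : fmes A -> 0 < B ->
  (forall x, A x -> forall i, - B <= x 0 i < B) -> 0 < vol A ->
  exists s, [/\ all bpos s, pairwise bsep s,
    vol (bunion s `\` A) <= vol A / 40, 39 / 40 * vol A <= tvol s & tvol s <= 41 / 40 * vol A].
Proof.
move=> fA B0 AB A0; have e0 : 0 < vol A / 40 by lra.
have [s [ps ds h1 h2]] := box_approx fA.1 B0 AB e0.
have fs := fmes_bunion ps; exists s; split => //; rewrite -vol_bunion//.
- have := volDI fA fs.1.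
  have : vol (A `&` bunion s) <= vol (bunion s) by apply: le_vol_outer => // x [].
  lra.
- rewrite (volDI fs fA.1).
  have : vol (bunion s `&` A) <= vol A by apply: le_vol_outer => // x [].
  lra.
Qed.

(** Error budget: two approximation errors of [1/39], and [40/39 * 6/7] for staying in the set, from
    [expR e >= 7/6]. Together they leave more than [1/20] for the paths that cross the boundary. *)
Lemma ratio_arith (R : realType) (a sig b C p q e X : R) :
  0 < a -> 0 < b -> p <= sig / 40 -> q <= C / 40 -> 0 < sig -> 0 < C ->
  39 / 40 * sig <= a -> a <= 41 / 40 * sig -> 39 / 40 * C <= b -> 1 / 6 <= e ->
  1 <= p / a + q / b + sig / (a * expR e) + X -> 1 / 20 <= X.
Proof.
move=> a0 b0 hp hq sig0 C0 as2 as1 bC he H.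
have H1 : p / a <= 1 / 39 by rewrite ler_pdivrMr//; lra.
have H2 : q / b <= 1 / 39 by rewrite ler_pdivrMr//; lra.
have ex : 7 / 6 <= expR e by apply: le_trans (expR_ge1Dx _); lra.
have H3 : sig / (a * expR e) <= 40 / 39 * (6 / 7).
  rewrite ler_pdivrMr ?mulr_gt0 ?expR_gt0//.
  have : a * (7 / 6) <= a * expR e by rewrite ler_pM2l.
  lra.
lra.
Qed.

(** * The deep case: following segments *)

Section inner.
Context (R : realType) (n : nat).
Variables (Q K : set 'rV[R]_n) (x0 y0 : 'rV[R]_n) (r Rad B : R).
Hypotheses (cQ : cvx Q) (uQ : unconditional Q) (nQ : Q !=set0).
Hypotheses (cK : cvx K) (r0 : 0 < r) (R0 : 0 < Rad) (rR : r <= Rad).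
Hypothesis inK : forall q, Q q -> K (x0 + r *: q).
Hypothesis outK : forall x, K x -> exists2 q, Q q & x = y0 + Rad *: q.
Hypotheses (fK : fmes K) (B0 : 0 < B) (n0 : (0 < n)%N).
Hypothesis boxK : forall x, K x -> forall i, - B <= x 0 i < B.
Variables (S M : set 'rV[R]_n).
Hypotheses (SK : S `<=` K) (mS : mes S) (fM : fmes M).
Hypothesis bdM : boundary0 K S `<=` M.

(** By convexity the path never leaves the core, so it must leave [S] itself. In the step where this
    happens the displacement lies in [d r Q], so all partial updates remain in [K]. *)
Lemma path_exits (d tau : R) (N : nat) : 0 < d < 1 -> (0 < N)%N -> 0 <= tau <= 1 ->
  tau / N%:R * (2 * Rad) <= d * r ->
  forall x z, (S `&` core K x0 d) x -> core K x0 d z ->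
     ~ (S `&` core K x0 d) (mix (fun=> tau) x z) ->
     exists k : 'I_N, exists i : 'I_n, M (mix (stair tau k i) x z).
Proof.
move=> /andP[d0 d1] N0 /andP[tau0 tau1] small x z [Sx Cx] Cz nS.
have N0' : 0 < N%:R :> R by rewrite ltr0n.
have h0 : 0 <= tau / N%:R by rewrite divr_ge0// ltW.
pose p (k : nat) := mix (fun=> tau * (k%:R / N%:R)) x z.
have pE k : p k = (1 - tau * (k%:R / N%:R)) *: x + (tau * (k%:R / N%:R)) *: z.
  by apply/rowP => j; rewrite !mxE.
have Cp k : (k <= N)%N -> core K x0 d (p k).
  move=> kN; rewrite pE; apply: core_convex => //.
  have kN1 : 0 <= (k%:R / N%:R : R) <= 1.
    by rewrite divr_ge0 ?ler0n//= ler_pdivrMr// mul1r ler_nat.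
  case/andP: kN1 => ? ?; apply/andP; split; nra.
have [k [kN Sk nSk]] : exists k, [/\ (k < N)%N, S (p k) & ~ S (p k.+1)].
  apply: contrapT => hno.
  have H k : (k <= N)%N -> S (p k).
    elim: k => [_|k IH kN]; first by rewrite pE mul0r mulr0 subr0 scale1r scale0r addr0.
    by apply: contrapT => nSk; apply: hno; exists k; split => //; exact: IH (ltnW kN).
  apply: nS; rewrite (_ : mix _ _ _ = p N); first by split; [exact: H|exact: Cp].
  by rewrite /p divff ?gt_eqF// mulr1.
have pk1 : p k.+1 - p k = (tau / N%:R) *: (z - x).
  by apply/rowP => j; rewrite !mxE -natr1; field; rewrite gt_eqF.
have CK : core K x0 d `<=` K by apply: (core_sub cQ uQ nQ cK inK); rewrite !ltW.
have [q Qq zxq] := diff_in cQ uQ outK (CK _ Cx) (CK _ Cz).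
have dr0 : 0 < d * r by rewrite mulr_gt0.
pose a := tau / N%:R * (2 * Rad) / (d * r).
have a01 : 0 <= a <= 1.
  rewrite ler_pdivrMr// mul1r small andbT divr_ge0//; last exact: ltW.
  by rewrite mulr_ge0// mulr_ge0// ltW.
have Qa := uncZ cQ uQ nQ a01 Qq.
have [i bi] : exists i : 'I_n, boundary0 K S (hybrid (fun j => (j <= i)%N) (p k) (p k.+1)).
  apply: crossing => // P.
  (* With [kap = 1] the whole depth may be spent: the partial updates only have to stay in
     [core 0 = K]. *)
  have := @core_hybrid _ _ Q cQ uQ K x0 r cK inK d 1 (p k) (p k.+1) (a *: q) P (ltW d0) d1.
  rewrite subrr mul0r core0; apply => //; [|exact: Cp (ltnW kN)|].
    by rewrite ler01 lexx.
  rewrite pk1 zxq !scalerA; congr (_ *: q); rewrite /a.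
  by field; rewrite !gt_eqF.
exists (Ordinal kN), i; apply: bdM; move: bi; congr (boundary0 K S _).
by apply/rowP => j; rewrite !mxE /stair /=; case: ifP.
Qed.

(* [tau] is about [1 / ln (b / a)], [a] and [b] being the volumes of source and
   target: by then the interpolation has left [S] with constant probability. *)
Lemma inner_bound (delta : R) : 0 < delta <= 20^-1 ->
  0 < vol S <= vol K / 2 ->
  vol S / 10 <= vol (S `&` core K x0 (delta / n%:R)) ->
  delta * (r / Rad) / n%:R * Num.min 1 ((1 - ln (vol S / vol K)) / n%:R) * vol S
    <= 20 * (10 * 42) * vol M.
Proof.
move=> /andP[del0 del1] /andP[S0 SK2] hS1.
have n0' : 0 < n%:R :> R by rewrite ltr0n.
have n1' : 1 <= n%:R :> R by rewrite ler1n.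
pose d := delta / n%:R; rewrite -/d in hS1.
have nd : n%:R * d = delta by rewrite /d mulrC divfK// gt_eqF.
have d0 : 0 < d by rewrite divr_gt0.
have d1 : d < 1 by rewrite /d ltr_pdivrMr// mul1r; apply: lt_le_trans n1'; apply: le_lt_trans del1 _; rewrite invf_lt1 ?ltr1n.
have d01 : 0 < d < 1 by rewrite d0 d1.
have K0 : 0 < vol K.
  by move: (lt_le_trans S0 SK2); rewrite pmulr_lgt0 ?invr_gt0.
pose C := core K x0 d.
have CK : C `<=` K by apply: (core_sub cQ uQ nQ cK inK); rewrite !ltW.
have fC : fmes C := fmes_core x0 d1 fK.
have fS : fmes S by exact: fmes_sub fK.
have fS1 : fmes (S `&` C) := fmesIl fS fC.1.
have C95 : 19 / 20 * vol K <= vol C.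
  have d01' : 0 <= d < 1 by rewrite ltW.
  have h1 := vol_core_compl cQ uQ nQ cK inK d01' fK.
  have h2 := volDI fK fC.1; rewrite (_ : K `&` C = C) in h2; last exact/setIidPr.
  have h3 := ler_wpM2r (ltW K0) del1.
  move: h1 h2 h3; rewrite nd -/C; lra.
have C0 : 0 < vol C by apply: lt_le_trans C95; rewrite mulr_gt0// divr_gt0.
set sig := vol (S `&` C) in hS1.
have sig0 : 0 < sig by apply: lt_le_trans hS1; rewrite divr_gt0.
have sigS : sig <= vol S by apply: le_vol_outer => // x [].
have [s [ps ds hs as2 as1]] := box_approx_ratio fS1 B0 (fun x h => boxK (SK h.1)) sig0.
have [t [pt dt ht at2 _]] := box_approx_ratio fC B0 (fun x h => boxK (CK _ h)) C0.
rewrite -/sig in hs as2 as1.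
have a0 : 0 < tvol s by apply: lt_le_trans as2; rewrite mulr_gt0// divr_gt0.
have b0 : 0 < tvol t by apply: lt_le_trans at2; rewrite mulr_gt0// divr_gt0.
have aS : tvol s <= 41 / 40 * vol S by move: as1 sigS; lra.
have bK : 9 / 10 * vol K <= tvol t by move: at2 C95 K0; lra.
have [el3 el_lam] := log_ratio_bound a0 b0 S0 K0 aS bK SK2.
have el0 : 0 < ln (tvol t) - ln (tvol s) by apply: lt_le_trans el3; rewrite divr_gt0.
have ab : tvol s <= tvol t by rewrite -ler_ln ?posrE// -subr_ge0 ltW.
(* The longest safe relative step: differences of points of [K] lie in [2 Rad Q], and depth [d]
   allows moves in [d r Q]. *)
pose t0 := d * (r / Rad) / 2.
have ra0 : 0 < r / Rad by rewrite divr_gt0.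
have ra1 : r / Rad <= 1 by rewrite ler_pdivrMr// mul1r.
have t00 : 0 < t0 by rewrite !mulr_gt0 ?invr_gt0.
have [tau [N [tau02 te N0 tN NX]]] := step_count el3 t00.
have tau01 : 0 <= tau <= 1.
  by case/andP: tau02 => -> /le_trans/= -> //; rewrite invf_le1 ?ler1n.
have small : tau / N%:R * (2 * Rad) <= d * r.
  by rewrite -ler_pdivlMr ?mulr_gt0// (le_trans tN)// /t0 le_eqVlt; apply/orP; left;
    apply/eqP; field; rewrite gt_eqF.
have nh : 4 * n%:R * (tau / N%:R) <= 1.
  have h1 : 4 * n%:R * (tau / N%:R) <= 4 * n%:R * t0 by rewrite ler_pM2l ?mulr_gt0.
  apply: le_trans h1 _; rewrite (_ : _ * t0 = 2 * delta * (r / Rad)); last first.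
    by rewrite -nd /t0; field; rewrite gt_eqF.
  have h2 : 2 * delta <= 1 by lra.
  by apply: le_trans (ler_piMr _ ra1) h2; rewrite mulr_ge0// ltW.
have pth := path_exits d01 N0 tau01 small.
have H := transport_ineq ps pt ds dt a0 b0 ab fS1 fC fM tau02 N0 nh pth.
rewrite -/sig in H.
have H4 := ratio_arith a0 b0 hs ht sig0 C0 as2 as1 at2 te H.
have M0 := vol_ge0 M.
(* With [X = N n vol M]: [tvol s <= 40 X], hence [sig <= 40/39 * 40 X <= 42 X], and
   [vol S <= 10 sig]. *)
have H5 : vol S <= (10 * 42) * (N%:R * n%:R) * vol M.
  have h1 : 1 / 20 * tvol s <= N%:R * n%:R * (2 / tvol s) * vol M * tvol s by rewrite ler_pM2r.
  rewrite (_ : N%:R * n%:R * _ * vol M * tvol s = 2 * (N%:R * n%:R * vol M)) in h1; last first.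
    by field; rewrite gt_eqF.
  rewrite -mulrA; have X0 : 0 <= N%:R * n%:R * vol M by rewrite !mulr_ge0.
  by move: hS1 as2 h1 X0; move: (_ * vol M) => X *; lra.
have lam0 : 0 <= 1 - ln (vol S / vol K).
  rewrite subr_ge0 (le_trans _ (ler01))// ln_le0//.
  by rewrite ler_pdivrMr// mul1r (le_trans SK2)// ler_pdivrMr// ler_peMr ?ler1n// ltW.
by apply: (inner_arith n0 _ _ el0 lam0 M0 _ el_lam NX H5); rewrite ?del0 ?ra0//.
Qed.

End inner.

(** * Telescoping sums and geometric depth levels *)

Lemma shift_indices i q : [/\ (i + q + 1 + q <= i + q.*2 + 3)%N,
  (i + q.*2 + 3 + q <= i + 1 + (q * 3 + 2))%N, (i + 1 + q <= i + q + 1)%N &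
  (i + q <= i + q.*2 + 1)%N].
Proof. by split; lia. Qed.

Section numeric_outer.
Context (R : realType).
Implicit Types (f g G : nat -> R).

(** A shift by [k] is a superposition of [k] telescoping sums, each at most [B]. *)
Lemma sum_shift_le f (B : R) (a k J : nat) : (forall i, 0 <= f i <= B) ->
  \sum_(i < J) (f (i + a + k)%N - f (i + a)%N) <= k%:R * B.
Proof.
move=> fB; elim: k => [|k IH].
  by rewrite mul0r big1// => i _; rewrite addn0 subrr.
rewrite -natr1 mulrDl mul1r.
rewrite (eq_bigr (fun i : 'I_J => (f (i + a + k)%N - f (i + a)%N) +
  (f (i.+1 + (a + k))%N - f (i + (a + k))%N))); last first.
  by move=> i _; rewrite addnS addSn !addnA; ring.
rewrite big_split /=; apply: lerD => //.
rewrite (eq_bigr (fun i : 'I_J => f (i.+1 + (a + k))%N - f (i + (a + k))%N))//.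
rewrite -(big_mkord xpredT (fun i => f (i.+1 + (a + k))%N - f (i + (a + k))%N)).
rewrite (telescope_sumr (fun i => f (i + (a + k))%N))//.
have /andP[_ h1] := fB (J + (a + k))%N; have /andP[h2 _] := fB (0 + (a + k))%N.
by rewrite (le_trans _ h1)// gerBl.
Qed.

Lemma sum_shift2_ge f (a J : nat) : {homo f : i j / (i <= j)%N >-> i <= j} ->
  2 * f J - 2 * f (a.+1) <= \sum_(i < J) (f (i + a + 2)%N - f (i + a)%N).
Proof.
move=> fm; rewrite -(big_mkord xpredT (fun i => f (i + a + 2)%N - f (i + a)%N)).
rewrite (eq_bigr (fun i => (f (i.+1 + a)%N + f (i.+1 + a.+1)%N) - (f (i + a)%N + f (i + a.+1)%N))); last first.
  move=> i _; rewrite !addSn !addnS addn0; ring.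
rewrite (telescope_sumr (fun i => f (i + a)%N + f (i + a.+1)%N))// !add0n.
have h1 : f J <= f (J + a)%N by apply: fm; rewrite leq_addr.
have h2 : f J <= f (J + a.+1)%N by apply: fm; rewrite leq_addr.
have h3 : f a <= f a.+1 by apply: fm.
lra.
Qed.

(** [f] and [G] stand for the volumes of [S] and of the boundary hull in the core of level [i].
    After summation the left side is at least [(9/5 - 1/5 - 1 - 1/10) Sv = Sv / 2], while on the
    right each level is counted at most [3 q + 2] times. *)
Lemma outer_sum f G (Sv Mv eps n : R) (q J : nat) :
  {homo f : i j / (i <= j)%N >-> i <= j} ->
  (forall i, 0 <= f i <= Sv) -> (forall i, 0 <= G i <= Mv) -> 0 <= eps -> 0 <= n ->
  (forall i, f (i + q.*2 + 3)%N - f (i + q + 1)%N -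
     (1 + eps) * (f (i + q.*2 + 1)%N - f (i + q)%N) <=
     2 * n * (G (i + 1 + (q * 3 + 2))%N - G (i + 1)%N)) ->
  f (q.*2 + 2)%N <= Sv / 10 -> 9 / 10 * Sv <= f J -> eps * q.+1%:R <= 1 / 10 ->
  Sv <= 4 * n * (q * 3 + 2)%:R * Mv.
Proof.
move=> fm fB GB e0 n0 step hq hJ heps.
have h1 := sum_shift2_ge (q.*2 + 1) J fm.
have h2 := @sum_shift_le f Sv q 1 J fB.
have h3 := @sum_shift_le f Sv q q.+1 J fB.
have h4 := @sum_shift_le G Mv 1 (q * 3 + 2) J GB.
have : \sum_(i < J) ((f (i + (q.*2 + 1) + 2)%N - f (i + (q.*2 + 1))%N) -
    (f (i + q + 1)%N - f (i + q)%N) - eps * (f (i + q + q.+1)%N - f (i + q)%N)) <=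
    \sum_(i < J) 2 * n * (G (i + 1 + (q * 3 + 2))%N - G (i + 1)%N).
  apply: ler_sum => i _; apply: le_trans (step i).
  have -> : (i + (q.*2 + 1) + 2 = i + q.*2 + 3)%N by rewrite -!addnA.
  have -> : (i + (q.*2 + 1) = i + q.*2 + 1)%N by rewrite -!addnA.
  have -> : (i + q + q.+1 = i + q.*2 + 1)%N by rewrite -!addnA -addnn !addnA addn1 addnS.
  by rewrite le_eqVlt; apply/orP; left; apply/eqP; ring.
rewrite sumrB -!mulr_sumr sumrB => h5.
have S0 : 0 <= Sv by have /andP[/le_trans h /h] := fB 0%N.
have n2 : 0 <= 2 * n by rewrite mulr_ge0.
have h6 := ler_wpM2l n2 h4; have h7 := ler_wpM2l e0 h3.
have h8 := ler_wpM2r S0 heps; rewrite mulrA in h7.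
have e1 : (q.*2 + 1).+1 = (q.*2 + 2)%N by rewrite -addn1 -addnA.
have e3 : 4 * n * (q * 3 + 2)%:R * Mv = 2 * (2 * n * ((q * 3 + 2)%:R * Mv)) by ring.
rewrite e1 in h1; rewrite e3; rewrite mul1r in h2.
move: h1 h2 h5 h6 h7 h8 hq hJ; clear => *; lra.
Qed.

Lemma inv_pow_le (t : R) n : 0 <= t -> n%:R * t <= 2^-1 -> t < 1 ->
  1 <= (1 + 2 * (n%:R * t)) * (1 - t) ^+ n /\ 2^-1 <= (1 - t) ^+ n.
Proof.
move=> t0 nt t1; have := @bernoulli_sub _ n t; rewrite t0 (ltW t1) => /(_ isT).
have : 0 <= n%:R * t by rewrite mulr_ge0.
move: (n%:R * t) nt ((1 - t) ^+ n) => x hx p x0 hp; split; last by lra.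
have : (1 + 2 * x) * (1 - x) <= (1 + 2 * x) * p by rewrite ler_wpM2l//; lra.
nra.
Qed.

Lemma bernoulli_add (x : R) k : 0 <= x -> 1 + k%:R * x <= (1 + x) ^+ k.
Proof.
move=> x0; elim: k => [|k IH]; first by rewrite mul0r addr0 expr0.
rewrite exprS -natr1; have x1 : 0 <= 1 + x by lra.
apply: le_trans (ler_wpM2l x1 IH).
have : 0 <= k%:R * x * x by rewrite !mulr_ge0.
lra.
Qed.

Definition level (D w : R) (j : nat) : R := D / (1 + w) ^+ j.

Section levels.
Variables (D w : R).
Hypotheses (D0 : 0 < D) (w0 : 0 < w).

Let w1 k : 0 < (1 + w) ^+ k. Proof. by rewrite exprn_gt0// addr_gt0. Qed.

Lemma level_gt0 j : 0 < level D w j.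
Proof. by rewrite divr_gt0. Qed.

Lemma levelD j k : level D w j = (1 + w) ^+ k * level D w (j + k).
Proof.
rewrite /level exprD; field.
by rewrite !gt_eqF.
Qed.

Lemma level_le i j : (i <= j)%N -> level D w j <= level D w i.
Proof.
move=> ij; rewrite (levelD i (j - i)) subnKC//.
have h1 : 1 <= (1 + w) ^+ (j - i) by rewrite exprn_ege1// lerDl ltW.
by apply: ler_peMl => //; exact/ltW/level_gt0.
Qed.

Lemma level_le0 j : level D w j <= D.
Proof. by apply: le_trans (level_le (leq0n j)) _; rewrite /level expr0 divr1. Qed.

Lemma level_jump q j : 3 <= q%:R * w -> 4 * level D w (j + q) <= level D w j.
Proof.
move=> hq; rewrite (levelD j q) ler_pM2r ?level_gt0//.
by apply: le_trans (bernoulli_add q (ltW w0)); lra.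
Qed.

Lemma level_ge k (c : R) : k%:R * w <= c -> D * expR (- c) <= level D w k.
Proof.
move=> kc; rewrite ler_pM2l// expRN lef_pV2 ?posrE ?expR_gt0//.
apply: (@le_trans _ _ (expR w ^+ k)).
  apply: lerXn2r (expR_ge1Dx w); rewrite nnegrE; last exact: expR_ge0.
  exact/ltW/addr_gt0.
by rewrite -expRM_natl ler_expR.
Qed.

Lemma level_small (c : R) : 0 < c -> exists J, level D w J <= c.
Proof.
move=> c0; exists (Num.truncn (D / (c * w))).+1; set J := _.+1.
rewrite ler_pdivrMr// mulrC -ler_pdivrMr//.
apply: le_trans (bernoulli_add J (ltW w0)).
have : D / (c * w) < J%:R by exact: truncnS_gt.
rewrite invfM mulrA ltr_pdivrMr// => /ltW h; apply: le_trans h _.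
by rewrite lerDr.
Qed.

End levels.

End numeric_outer.

(** * The shallow case: dilations towards the centre *)

Section outer.
Context (R : realType) (n : nat).
Variables (Q K : set 'rV[R]_n) (x0 y0 : 'rV[R]_n) (r Rad : R).
Hypotheses (cQ : cvx Q) (uQ : unconditional Q) (nQ : Q !=set0).
Hypotheses (cK : cvx K) (r0 : 0 < r) (R0 : 0 < Rad) (rR : r <= Rad).
Hypothesis inK : forall q, Q q -> K (x0 + r *: q).
Hypothesis outK : forall x, K x -> exists2 q, Q q & x = y0 + Rad *: q.
Hypotheses (fK : fmes K) (n0 : (0 < n)%N).
Variables (S M : set 'rV[R]_n).
Hypotheses (SK : S `<=` K) (mS : mes S) (fM : fmes M).
Hypothesis bdM : boundary0 K S `<=` M.

(** With the factor 12, a dilation by [t = 3 om d] displaces a point by some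
    [t * (2 Rad) q = (d / 2) r q], half of what depth [d] allows. *)
Let om := r / (12 * Rad).
Let cr := core K x0.

Let om0 : 0 < om. Proof. by rewrite divr_gt0// mulr_gt0. Qed.
Let om12 : om <= 12^-1.
Proof. by rewrite ler_pdivrMr ?mulr_gt0// mulrA mulVf// mul1r. Qed.

Let crS a b : 0 <= a -> a <= b -> b <= 1 -> cr b `<=` cr a.
Proof. exact: (core_mono cQ uQ nQ cK inK). Qed.

Lemma vol_capB (X : set 'rV[R]_n) a b : fmes X -> 0 <= a -> a <= b -> b < 1 ->
  vol ((X `&` cr a) `\` cr b) = vol (X `&` cr a) - vol (X `&` cr b).
Proof.
move=> fX a0 ab b1; have fa := fmes_core x0 (le_lt_trans ab b1) fK.
have fb := fmes_core x0 b1 fK.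
rewrite (volDI (fmesIl fX fa.1) fb.1) (_ : X `&` _ `&` _ = X `&` cr b) ?addrK//.
apply/seteqP; split=> x; first by move=> [[]].
by move=> [Xx bx]; split => //; split => //; apply: (crS a0 ab (ltW b1)).
Qed.

(* The dilation [x |-> (1 - t) x + t x0], [t = 3 om d], pushes the shell between
   depths [d] and [D] inwards; the points of [S] in that shell that leave [S]
   must cross [M] at a comparable depth while their coordinates are updated. *)
Lemma outer_step d D : 0 < d -> d <= 4^-1 -> 3 * d <= D -> (1 + om) * D < 1 ->
  D + d / 2 < 1 -> n%:R * (3 * om * d) <= 2^-1 ->
  vol (S `&` cr d) - vol (S `&` cr D) -
    (1 + 2 * (n%:R * (3 * om * d))) *
      (vol (S `&` cr ((1 + om) ^+ 2 * d)) - vol (S `&` cr ((1 + om) * D))) <=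
  2 * n%:R * (vol (M `&` cr (d / 2)) - vol (M `&` cr (D + d / 2))).
Proof.
have o0 := om0; have o12 := om12.
move=> d0 d4 dD omD Dd nt; have D0 : 0 < D by lra.
have oD0 : 0 < om * D by rewrite mulr_gt0.
have od0 : 0 < om * d by rewrite mulr_gt0.
have D1 : D < 1 by lra.
pose t := 3 * om * d; rewrite -/t in nt *.
have t0 : 0 < t by rewrite /t -mulrA mulr_gt0.
have t1 : t < 1.
  have : om * d <= 12^-1 * d by rewrite ler_wpM2r// ltW.
  by rewrite /t -mulrA; lra.
have [pow1 pow2] := inv_pow_le (ltW t0) nt t1.
have fS : fmes S by exact: fmes_sub fK.
have e2 : (1 + om) ^+ 2 * d = d + (2 + om) * (om * d) by ring.
(* The shallow edge advances by two levels: [3 (1 - d) >= 2 + om], because [d <= 1/4] and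
   [om <= 1/12]. *)
have eD : d + (2 + om) * (om * d) <= d + t * (1 - d).
  rewrite lerD2l (_ : t * _ = (3 * (1 - d)) * (om * d)); last by rewrite /t; ring.
  by rewrite ler_pM2r//; lra.
have ed1 : d + t * (1 - d) < 1.
  by rewrite -subr_gt0 (_ : _ - _ = (1 - t) * (1 - d)); [rewrite mulr_gt0; lra|ring].
have d2D : (1 + om) ^+ 2 * d <= (1 + om) * D.
  rewrite expr2 -mulrA ler_pM2l; last by lra.
  by apply: le_trans dD; rewrite ler_pM2r//; lra.
pose Tx (x : 'rV[R]_n) := (1 - t) *: x + t *: x0.
pose Tb := fun j : 'I_n => t * x0 0 j.
have TE x : Tx x = \row_j (Tb j + (1 - t) * x 0 j).
  by apply/rowP => j; rewrite !mxE addrC.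
have fd : fmes (cr d) by apply: fmes_core fK; lra.
have fDD : fmes (cr D) by exact: fmes_core fK.
have fd2 : fmes (cr ((1 + om) ^+ 2 * d)) by apply: fmes_core fK; exact: le_lt_trans omD.
have fD2 : fmes (cr ((1 + om) * D)) by exact: fmes_core fK.
pose A := (S `&` cr d) `\` cr D.
have fA : fmes A by apply: fmesD; [exact: fmesIl fd.1|exact: fDD.1].
pose SD := (S `&` cr ((1 + om) ^+ 2 * d)) `\` cr ((1 + om) * D).
have fSD : fmes SD by apply: fmesD; [exact: fmesIl fd2.1|exact: fD2.1].
have t1' : 0 < 1 - t by rewrite subr_gt0.
(* Points whose image stays in [S] are mapped into the shell [SD]; undoing the Jacobian
   [(1 - t) ^ n] costs the factor [1 + 2 n t]. *)
have hF : vol (A `&` [set x | S (Tx x)]) <= (1 + 2 * (n%:R * t)) * vol SD.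
  pose U := [set x : 'rV[R]_n | SD (\row_j (Tb j + (1 - t) * x 0 j))].
  have fU : fmes U by exact: (@fmes_affine _ _ Tb (fun=> 1 - t) SD (fun=> t1') fSD).
  have vU := @vol_affine _ _ Tb (fun=> 1 - t) SD (fun=> t1') fSD.
  rewrite prodr_const card_ord in vU.
  have AU : vol (A `&` [set x | S (Tx x)]) <= vol U.
    apply: le_vol_outer fU; move=> x [[[Sx dx] nDx] STx]; rewrite /U /= -TE; split.
      split => //; have := core_dilate t dx.
      apply: crS; [by rewrite mulr_ge0 ?exprn_ge0//; lra|by rewrite e2|exact: ltW].
    move=> DTx; apply: nDx; have := core_dilate_back t1 DTx.
    apply: crS; [exact: ltW| |].
      rewrite ler_pdivlMr//.
      (* The deep edge advances by at most one level, because [3 d <= D]. *)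
      have : t <= om * D by rewrite /t -mulrA mulrCA ler_pM2l.
      have : 0 <= t * D by rewrite mulr_ge0// ltW.
      lra.
    by rewrite ler_pdivrMr//; lra.
  apply: le_trans AU _; rewrite -vU -/U mulrA ler_peMl ?vol_ge0//.
have mT : mes [set x | S (Tx x)].
  have -> : [set x | S (Tx x)] = [set x : 'rV[R]_n | S (\row_j (Tb j + (1 - t) * x 0 j))].
    by apply/seteqP; split => x /=; rewrite TE.
  exact: (@mes_affine _ _ Tb (fun=> 1 - t)).
pose MD := (M `&` cr (d / 2)) `\` cr (D + d / 2).
have fMD : fmes MD.
  apply: fmesD; last by case: (fmes_core x0 Dd fK).
  by apply: fmesIl => //; case: (fmes_core x0 (_ : d / 2 < 1) fK) => //; lra.
(* For each [i], updating the coordinates up to [i] is an affine map of Jacobian at least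
   [(1 - t) ^ n >= 1/2]. A point that leaves [S] is sent into [MD] by one of these [n] maps. *)
have hE : vol (A `\` [set x | S (Tx x)]) <= 2 * n%:R * vol MD.
  pose ai (i : 'I_n) (j : 'I_n) := if (j <= i)%N then Tb j else 0.
  pose bi (i : 'I_n) (j : 'I_n) := if (j <= i)%N then 1 - t else 1.
  have bi0 i j : 0 < bi i j by rewrite /bi; case: ifP.
  pose U i := [set x : 'rV[R]_n | MD (\row_j (ai i j + bi i j * x 0 j))].
  have fU i : fmes (U i) by exact: (@fmes_affine _ _ (ai i) (bi i) MD (bi0 i) fMD).
  have vU i : vol (U i) <= 2 * vol MD.
    have := @vol_affine _ _ (ai i) (bi i) MD (bi0 i) fMD; rewrite -/(U i) => <-.
    have : (1 - t) ^+ n <= \prod_j bi i j.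
      rewrite -{1}(card_ord n) -prodr_const; apply: ler_prod => j _.
      by rewrite (ltW t1') /bi /=; case: ifP => _; rewrite ?lexx// gerBl ltW.
    move=> /(le_trans pow2)/(ler_wpM2r (vol_ge0 (U i))); lra.
  apply: (@le_trans _ _ (vol (\big[setU/set0]_(i : 'I_n) U i))).
    apply: le_vol_outer (fmes_big_setU _ fU).
    move=> x [[[Sx dx] nDx] nSTx].
    have [q Qq xq] := diff_in cQ uQ outK (SK Sx) (center_in cQ uQ nQ inK).
    have Tq : Tx x - x = (2^-1 * d * r) *: q.
      have -> : Tx x - x = t *: (x0 - x) by apply/rowP => j; rewrite !mxE; ring.
      rewrite xq scalerA; congr (_ *: q); rewrite /t /om; field.
      by rewrite gt_eqF.
    have d1 : d < 1 by lra.
    have hy P : cr (d / 2) (hybrid P x (Tx x)).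
      have k01 : 0 <= (2^-1 : R) <= 1 by apply/andP; split; lra.
      have := core_hybrid cQ uQ cK inK P (ltW d0) d1 k01 dx Qq Tq.
      by rewrite (_ : (1 - 2^-1) * d = d / 2)//; field.
    have h01 : 0 <= d / 2 <= 1 by apply/andP; split; lra.
    have hyK P : K (hybrid P x (Tx x)) := core_sub cQ uQ nQ cK inK h01 (hy P).
    have [i bi'] := crossing Sx nSTx hyK.
    rewrite -bigcup_seq; exists i; first exact: mem_index_enum.
    rewrite /U /= (_ : \row_j _ = hybrid (fun j => (j <= i)%N) x (Tx x)); last first.
      by apply/rowP => j; rewrite !mxE /ai /bi /Tb; case: ifP => _; ring.
    split; first by split; [exact: bdM|exact: hy].
    (* An image of depth [D + d / 2], moved back at the cost of [d / 2], would put [x] in the core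
       of depth [D]. *)
    rewrite hybridE Tq coord_restrictZ => hD; apply: nDx.
    have k0 : (0 : R) <= 2^-1 by rewrite invr_ge0.
    have kD : 2^-1 * d <= D + d / 2 by lra.
    have D00 : 0 < D + d / 2 by lra.
    have := core_move_back uQ cK inK (ltW d0) k0 kD D00 Dd (unc_restrict cQ uQ _ Qq) hD.
    by rewrite (_ : D + d / 2 - 2^-1 * d = D)//; ring.
  apply: le_trans (vol_big_setU_le _ fU) _.
  apply: (@le_trans _ _ (\sum_(i : 'I_n) 2 * vol MD)); first exact: ler_sum.
  rewrite sumr_const card_ord -[leLHS]mulr_natl le_eqVlt; apply/orP; left; apply/eqP; ring.
have vA := volDI fA mT.
have vA' : vol A = vol (S `&` cr d) - vol (S `&` cr D) by apply: vol_capB => //; lra.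
have vSD : vol SD = vol (S `&` cr ((1 + om) ^+ 2 * d)) - vol (S `&` cr ((1 + om) * D)).
  by apply: vol_capB => //; rewrite mulr_ge0 ?exprn_ge0//; lra.
have vMD : vol MD = vol (M `&` cr (d / 2)) - vol (M `&` cr (D + d / 2)).
  by apply: vol_capB => //; lra.
rewrite -vA' -vSD -vMD vA; move: hF hE; set p := vol _; set p' := vol _; set c := _ * vol SD.
by set e := 2 * _ * _ => ? ?; lra.
Qed.

(* Summed over the depths [level D0 om j], [outer_step] gains two shells of [S] at
   depth [d] for one lost at depth [D], since [t] is proportional to [d] and
   [D >= 3 d]; the boundary is counted [O(q)] times. *)
Lemma outer_bound (D0 : R) : 0 < D0 -> 24 * (n%:R * D0) <= 1 / 10 -> 0 < vol S ->
  vol (S `&` cr (D0 * expR (- 8))) <= vol S / 10 ->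
  r / Rad / n%:R * vol S <= 12 * 40 * vol M.
Proof.
move=> D0p nD0 S0 hdeep; have o0 := om0; have o12 := om12.
have n0' : 0 < n%:R :> R by rewrite ltr0n.
have n1' : 1 <= n%:R :> R by rewrite ler1n.
have fS : fmes S by exact: fmes_sub fK.
have D0n : D0 <= n%:R * D0 by apply: ler_peMl => //; exact: ltW.
have D8 : D0 <= 1 / 8 by lra.
pose l := level D0 om.
have l0 j : 0 < l j := level_gt0 D0p o0 j.
have lD j : l j <= D0 := level_le0 D0p o0 j.
have l1 j : l j <= 1 by apply: le_trans (lD j) _; lra.
have l1' j : l j < 1 by apply: le_lt_trans (lD j) _; lra.
have lmono i j : (i <= j)%N -> l j <= l i := level_le D0p o0 (i:=i) (j:=j).
(* [q] levels multiply the depth by at least [1 + q om >= 4]. *)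
have [q [q1 q2]] : exists q : nat, 3 <= q%:R * om /\ q%:R * om <= 3 + om.
  exists (Num.truncn (3 / om)).+1; split.
    by rewrite -ler_pdivrMr// ltW// truncnS_gt.
  have h : (Num.truncn (3 / om)).+1%:R <= 3 / om + 1.
    by rewrite -natr1 lerD2r truncn_le// divr_ge0// ltW.
  by move/(ler_wpM2r (ltW o0)): h; rewrite [X in _ <= X]mulrDl divfK ?gt_eqF// mul1r.
have fcr j : fmes (cr (l j)) := fmes_core x0 (l1' j) fK.
pose vX (X : set 'rV[R]_n) j := vol (X `&` cr (l j)).
have vXmono X : fmes X -> {homo vX X : i j / (i <= j)%N >-> i <= j}.
  move=> fX i j ij; apply: le_vol_outer; last by apply: fmesIl => //; case: (fcr j).
  by move=> x [Xx ix]; split => //; apply: (crS (ltW (l0 j)) (lmono _ _ ij) (l1 i)).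
have vXB X j : fmes X -> 0 <= vX X j <= vol X.
  by move=> fX; rewrite vol_ge0 /=; apply: le_vol_outer => // x [].
pose eps := 6 * (n%:R * D0) * om.
have nD00 : 0 <= n%:R * D0 := ltW (mulr_gt0 n0' D0p).
have eps0 : 0 <= eps by rewrite /eps mulr_ge0//; [rewrite mulr_ge0|exact: ltW].
have n00 : 0 <= n%:R :> R by [].
(* Since [om * (q + 1) <= 4], this is the origin of the factor [24 = 6 * 4] in the hypothesis on
   [D0]. *)
have heps : eps * q.+1%:R <= 1 / 10.
  have -> : eps * q.+1%:R = 6 * (n%:R * D0) * (q%:R * om + om).
    by rewrite -[q.+1%:R]natr1 /eps; move: (q%:R : R) => Z; ring.
  have h : 6 * (n%:R * D0) * (q%:R * om + om) <= 6 * (n%:R * D0) * 4.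
    by apply: ler_wpM2l; [rewrite mulr_ge0|lra].
  apply: le_trans h _; lra.
have hq : vX S (q.*2 + 2)%N <= vol S / 10.
  apply: le_trans hdeep; apply: le_vol_outer.
    move=> x [Sx lx]; split => //; apply: crS lx => //.
      by rewrite mulr_ge0 ?expR_ge0// ltW.
    apply: level_ge => //; rewrite natrD -muln2 natrM mulrDl mulrAC; lra.
  have : D0 * expR (- 8) < 1.
    apply: le_lt_trans (_ : D0 * 1 < 1); last by lra.
    by rewrite ler_pM2l// -expR0 ler_expR oppr_le0.
  by move=> /(fmes_core x0)/(_ fK)[mc _]; exact: fmesIl.
have vK0 : 0 < vol K by apply: lt_le_trans S0 _; exact: le_vol_outer.
(* The layer of [K] above depth [l J] has volume at most [n (l J) vol K], which is below
   [vol S / 10] for large [J]. *)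
have [J hJ] : exists J, 9 / 10 * vol S <= vX S J.
  have c0 : 0 < vol S / 10 / (n%:R * vol K) by rewrite !divr_gt0// mulr_gt0.
  have [J hJ] := level_small D0 o0 c0; exists J; rewrite -/l in hJ.
  have lJ : 0 <= l J < 1 by rewrite l1' ltW.
  have h1 := vol_core_compl cQ uQ nQ cK inK lJ fK.
  have h2 : n%:R * l J * vol K <= vol S / 10.
    by rewrite mulrAC mulrC -ler_pdivlMr// mulr_gt0.
  have h3 := volDI fS (fcr J).1.
  have h4 : vol (S `\` cr (l J)) <= vol (K `\` cr (l J)).
    apply: le_vol_outer; first by move=> x [/SK].
    by apply: fmesD => //; case: (fcr J).
  have h5 : vX S J = vol (S `&` cr (l J)) by [].
  rewrite h5; move: h1 h2 h3 h4; rewrite -/cr; lra.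
have step i : vX S (i + q.*2 + 3)%N - vX S (i + q + 1)%N -
     (1 + eps) * (vX S (i + q.*2 + 1)%N - vX S (i + q)%N) <=
     2 * n%:R * (vX M (i + 1 + (q * 3 + 2))%N - vX M (i + 1)%N).
  (* [d] lies at least [q] levels beyond [D], whence [4 d <= D]. A further [q] levels on either side
     leave room for the depths [d / 2] and [D + d / 2] where the boundary is met. *)
  have [s1 s2 s3 s4] := shift_indices i q.
  pose d := l (i + q.*2 + 3)%N; pose D := l (i + q + 1)%N.
  have e1 : l (i + q.*2 + 1)%N = (1 + om) ^+ 2 * d.
    by rewrite /l (levelD D0 o0 _ 2) /d /l -addnA.
  have e2 : l (i + q)%N = (1 + om) * D by rewrite /l (levelD D0 o0 _ 1) expr1.
  have e3 : 4 * d <= D.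
    apply: le_trans (level_jump D0p o0 (i + q + 1)%N q1).
    by apply: ler_wpM2l (ler0n _ _) _ _ _; exact: lmono s1.
  have e4 : 4 * l (i + 1 + (q * 3 + 2))%N <= d.
    apply: le_trans (level_jump D0p o0 (i + q.*2 + 3)%N q1).
    by apply: ler_wpM2l (ler0n _ _) _ _ _; exact: lmono s2.
  have e5 : 4 * D <= l (i + 1)%N.
    apply: le_trans (level_jump D0p o0 (i + 1)%N q1).
    by apply: ler_wpM2l (ler0n _ _) _ _ _; exact: lmono s3.
  have d0 : 0 < d := l0 _.
  have dD0 : d <= D0 := lD _.
  have DD0 : D <= D0 := lD _.
  have D1 : (1 + om) * D < 1 by rewrite -e2.
  have nd : n%:R * (3 * om * d) <= 3 * (n%:R * D0) * om.
    rewrite (_ : n%:R * _ = 3 * om * n%:R * d); last by ring.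
    rewrite (_ : _ * _ * om = 3 * om * n%:R * D0); last by ring.
    have c0 : 0 <= 3 * om * n%:R by rewrite mulr_ge0// mulr_ge0// ltW.
    exact: ler_wpM2l.
  have nd0 : 3 * (n%:R * D0) * om <= 3 * (n%:R * D0) * 12^-1.
    by apply: ler_wpM2l => //; rewrite mulr_ge0.
  have nd2 : n%:R * (3 * om * d) <= 2^-1 by apply: le_trans nd (le_trans nd0 _); lra.
  have st := outer_step d0 (_ : d <= 4^-1) (_ : 3 * d <= D) D1 (_ : D + d / 2 < 1) nd2.
  have {st}st := st ltac:(lra) ltac:(lra) ltac:(lra).
  rewrite -e1 -e2 in st.
  have m1 : 0 <= vX S (i + q.*2 + 1)%N - vX S (i + q)%N.
    by rewrite subr_ge0; exact: vXmono s4.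
  have m2 : (1 + 2 * (n%:R * (3 * om * d))) * (vX S (i + q.*2 + 1)%N - vX S (i + q)%N) <=
            (1 + eps) * (vX S (i + q.*2 + 1)%N - vX S (i + q)%N).
    by apply: ler_wpM2r => //; rewrite /eps; lra.
  have m3 : vol (M `&` cr (d / 2)) <= vX M (i + 1 + (q * 3 + 2))%N.
    apply: le_vol_outer; last by apply: fmesIl => //; case: (fcr (i + 1 + (q * 3 + 2))%N).
    move=> x [Mx dx]; split => //; apply: crS dx; [exact: ltW|lra|lra].
  have m4 : vX M (i + 1)%N <= vol (M `&` cr (D + d / 2)).
    apply: le_vol_outer.
      move=> x [Mx dx]; split => //; apply: crS dx; [lra|lra|exact: l1].
    have : D + d / 2 < 1 by lra.
    by move=> /(fmes_core x0)/(_ fK)[mc _]; exact: fmesIl.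
  have m5 : 2 * n%:R * (vol (M `&` cr (d / 2)) - vol (M `&` cr (D + d / 2))) <=
            2 * n%:R * (vX M (i + 1 + (q * 3 + 2))%N - vX M (i + 1)%N).
    by apply: ler_wpM2l; [rewrite mulr_ge0|exact: lerB].
  apply: le_trans m5; apply: le_trans st; rewrite lerB//.
have := outer_sum (vXmono S fS) (fun i => vXB S i fS) (fun i => vXB M i fM) eps0 n00 step hq hJ heps.
move=> /(ler_wpM2l (ltW o0)) h.
(* [3 (3 + om) + 2 om <= 10]; with the factor 4 of [outer_sum] and the 12 of [om] this gives
   [12 * 40]. *)
have h1 : om * (q * 3 + 2)%:R <= 10.
  rewrite natrD natrM mulrDr mulrA [om * _]mulrC; lra.
have nM : 0 <= 4 * n%:R * vol M by rewrite !mulr_ge0// vol_ge0.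
have h2 := ler_wpM2r nM h1.
rewrite mulrAC ler_pdivrMr//.
rewrite (_ : r / Rad * vol S = 12 * (om * vol S)); last first.
  by rewrite /om; field; rewrite gt_eqF.
rewrite -[leRHS]mulrA -[leRHS]mulrA ler_pM2l//; apply: le_trans h _.
rewrite (_ : om * _ = om * (q * 3 + 2)%:R * (4 * n%:R * vol M)); last by ring.
apply: le_trans h2 _; rewrite le_eqVlt; apply/orP; left; apply/eqP; ring.
Qed.

End outer.

(** * Combination of the two cases, and comparison of the coefficients *)

Section assembly.
Context (R : realType).

(* [inner_depth / n] is the depth [D0 / (1 + om) ^ (2 q + 2)] reached in
   [outer_bound], as [om * (q + 1) <= 4]. *)
Definition inner_depth : R := (24 * 10)^-1 * expR (- 8).

Definition iso_const : R := inner_depth / (20 * (10 * 42)).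

Lemma inner_depth_bounds : 0 < inner_depth <= 20^-1.
Proof.
have e1 : expR (- 8) <= (1 : R) by rewrite -expR0 ler_expR oppr_le0.
have k1 : (24 * 10)^-1 <= 20^-1 :> R by rewrite lef_pV2 ?posrE//; lra.
rewrite mulr_gt0 ?expR_gt0//=; apply: le_trans k1.
by rewrite ler_piMr.
Qed.

Lemma iso_const_gt0 : 0 < iso_const.
Proof. by have /andP[h _] := inner_depth_bounds; rewrite divr_gt0. Qed.

Section bodies.
Context (n : nat).
Variables (Q K : set 'rV[R]_n) (x0 y0 : 'rV[R]_n) (r Rad : R).
Hypotheses (n0 : (0 < n)%N) (r0 : 0 < r) (R0 : 0 < Rad).
Hypotheses (bQ : convex_body Q) (uQ : unconditional Q) (bK : convex_body K).
Hypothesis rQK : [set x0 + r *: q | q in Q] `<=` K.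
Hypothesis KRQ : K `<=` [set y0 + Rad *: q | q in Q].

Lemma boundary_hull_ge (S M : set 'rV[R]_n) : S `<=` K -> mes S -> fmes M ->
  boundary0 K S `<=` M -> 0 < vol S <= vol K / 2 ->
  iso_const * r / (n%:R * Rad) *
    Num.min 1 ((1 - ln (vol S / vol K)) / n%:R) * vol S <= vol M.
Proof.
case: bQ bK => kQ cQ' [q0 iq0] [kK cK' _].
move=> SK mS fM bdM /andP[S0 SK2].
have cQ := convex_set_cvx cQ'; have cK := convex_set_cvx cK'.
have nQ : Q !=set0 by exists q0; exact: interior_subset.
have inK q : Q q -> K (x0 + r *: q) by move=> Qq; apply: rQK; exists q.
have outK x : K x -> exists2 q, Q q & x = y0 + Rad *: q.
  by move=> /KRQ[q Qq <-]; exists q.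
have rR : r <= Rad by apply: (radius_le n0 r0 R0 kQ _ cQ uQ inK outK); exists q0.
have [B [B0 KB]] := compact_box kK.
have fK := compact_fmes kK.
have n0' : 0 < n%:R :> R by rewrite ltr0n.
set m := Num.min 1 _.
have K0 : 0 < vol K.
  by move: (lt_le_trans S0 SK2); rewrite pmulr_lgt0 ?invr_gt0.
have m1 : m <= 1 by rewrite ge_min lexx.
have /andP[del0 del1] := inner_depth_bounds.
have ra0 : 0 < r / Rad by rewrite divr_gt0.
have e : iso_const * r / (n%:R * Rad) * m * vol S =
    inner_depth * (r / Rad) / n%:R * m * vol S / (20 * (10 * 42)).
  by rewrite /iso_const; move: inner_depth => del; field; rewrite !gt_eqF.
have c0 : 0 < 20 * (10 * 42) :> R by rewrite !mulr_gt0.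
rewrite e ler_pdivrMr// [leRHS]mulrC.
have [deep|shallow] := leP (vol S / 10) (vol (S `&` core K x0 (inner_depth / n%:R))).
  apply: (inner_bound cQ uQ nQ cK r0 R0 rR inK outK fK B0 n0 KB SK mS fM bdM) => //.
  - by rewrite del0.
  - by rewrite S0.
(* [D0 * expR (- 8)] equals [inner_depth / n], so failure of the deep case is the hypothesis of
   [outer_bound]. Its conclusion has no logarithm and suffices because [m <= 1]. *)
pose D0 : R := (24 * 10)^-1 / n%:R.
have D0p : 0 < D0 by rewrite divr_gt0// invr_gt0 mulr_gt0.
have nD0 : 24 * (n%:R * D0) <= 1 / 10.
  by rewrite /D0 [n%:R * _]mulrC divfK ?gt_eqF//; lra.
have shallow' : vol (S `&` core K x0 (D0 * expR (- 8))) <= vol S / 10.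
  by rewrite /D0 mulrAC; exact: ltW.
have h := outer_bound cQ uQ nQ cK r0 R0 rR inK outK fK n0 SK mS fM bdM D0p nD0 S0 shallow'.
have X0 : 0 <= r / Rad / n%:R * vol S by rewrite mulr_ge0 ?vol_ge0// divr_ge0// ltW.
have m0 : 0 <= inner_depth * 1 by rewrite mulr1 ltW.
have im : inner_depth * m <= 1 by apply: le_trans (ler_wpM2l (ltW del0) m1) _; lra.
have -> : inner_depth * (r / Rad) / n%:R * m * vol S =
    inner_depth * m * (r / Rad / n%:R * vol S) by ring.
apply: le_trans (ler_wpM2r X0 im) _; rewrite mul1r; apply: le_trans h _.
have M0 := vol_ge0 M; lra.
Qed.

Lemma boundary_ge (S : set 'rV[R]_n) : S `<=` K -> borel S ->
  0 < vol S <= vol K / 2 ->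
  iso_const * r / (n%:R * Rad) *
    Num.min 1 ((1 - ln (vol S / vol K)) / n%:R) <= vol (boundary0 K S) / vol S.
Proof.
move=> SK /mes_borel mS SV; have /andP[S0 _] := SV.
have fK : fmes K by case: bK => kK _ _; exact: compact_fmes.
rewrite ler_pdivlMr//; apply: (le_vol_outer_hull _ fK); first by move=> x [[]].
by move=> M fM bM _; exact: boundary_hull_ge.
Qed.

End bodies.

Lemma ncoord_diff_sym n (x y : 'rV[R]_n) : ncoord_diff x y = ncoord_diff y x.
Proof. by apply: eq_card => i; rewrite !inE eq_sym. Qed.

(** The smaller of two axis-disjoint sets has at most half the volume of [K], and its [l_0] boundary
    misses the other set, hence lies in the separator. *)
Lemma xi0_le_psi0 n (K : set 'rV[R]_n) : compact K -> (xi0 K <= psi0 K)%E.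
Proof.
move=> kK; have fK := compact_fmes kK.
have H A B : A `<=` K -> B `<=` K -> borel A -> borel B -> axis_disjoint A B ->
    0 < vol A -> vol A <= vol B ->
    (xi0 K <= (vol (K `\` (A `|` B)) / vol A)%:E)%E.
  move=> AK BK bA bB AB A0 leAB.
  have mA := mes_borel bA; have mB := mes_borel bB.
  have dAB x : A x -> ~ B x.
    move=> Ax Bx; have := AB x x Ax Bx; rewrite /ncoord_diff.
    by rewrite (eq_card0 (A := [pred i | x 0 i != x 0 i]))// => i; rewrite !inE eqxx.
  have hA2 : vol A <= vol K / 2.
    have := volDI fK mA; rewrite (_ : K `&` A = A); last exact/setIidPr.
    have : vol B <= vol (K `\` A).
      apply: le_vol_outer; last exact: fmesD.
      by move=> x Bx; split; [exact: BK|move=> /dAB].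
    lra.
  apply: (@le_trans _ _ (vol (boundary0 K A) / vol A)%:E).
    by apply: ereal_inf_lbound; exists A => //; split => //; rewrite A0.
  rewrite lee_fin ler_pM2r ?invr_gt0//; apply: le_vol_outer.
    move=> y [[Ky nAy] [x Ax xy]]; split => // -[//|By].
    by have := AB x y Ax By; rewrite leqNgt ltnS xy.
  by apply: fmesD => //; exact: mesU.
apply/le_ereal_inf_tmp => _ [[A B] [[/= AK BK bA bB] [AB m0]] <-].
have /andP[A0 B0] : (0 < vol A) && (0 < vol B) by rewrite -lt_min.
have [le|/ltW le] := leP (vol A) (vol B); first exact: H.
rewrite setUC; apply: H => // x y Bx Ay.
by rewrite ncoord_diff_sym; exact: AB.
Qed.

End assembly.

Theorem theorem1p1 (R : realType) :
  exists2 c : R, 0 < c &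
  forall (n : nat) (r Rad : R) (Q K : set 'rV[R]_n) (x0 y0 : 'rV[R]_n),
    (2 <= n)%N -> 0 < r -> 0 < Rad ->
    convex_body Q -> unconditional Q -> convex_body K ->
    [set x0 + r *: q | q in Q] `<=` K ->
    K `<=` [set y0 + Rad *: q | q in Q] ->
    (forall S : set 'rV[R]_n, S `<=` K -> borel S ->
       0 < vol S <= vol K / 2 ->
       let s := vol S / vol K in
       let bound :=
         c * r / (n%:R * Rad) * Num.min 1 (ln (expR 1 / s) / n%:R) in
       [/\ bound <= vol (boundary0 K S) / vol S,
           expR (1 - n%:R) <= s ->
             bound = c * r / (n%:R ^+ 2 * Rad) * ln (expR 1 / s) &
           s <= expR (1 - n%:R) -> bound = c * r / (n%:R * Rad)]) /\
    ((c * r / (n%:R ^+ 2 * Rad))%:E <= xi0 K /\ xi0 K <= psi0 K)%E.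
Proof.
exists (iso_const R); first exact: iso_const_gt0.
move=> n r Rad Q K x0 y0 n2 r0 R0 bQ uQ bK rQK KRQ.
have n0 : (0 < n)%N by exact: ltnW.
have n0' : 0 < n%:R :> R by rewrite ltr0n.
have n1' : 1 <= n%:R :> R by rewrite ler1n.
have main := boundary_ge n0 r0 R0 bQ uQ bK rQK KRQ.
have c0 := iso_const_gt0 R.
have sP (S : set 'rV[R]_n) : 0 < vol S <= vol K / 2 ->
    [/\ 0 < vol S / vol K, vol S / vol K <= 1 &
        ln (expR 1 / (vol S / vol K)) = 1 - ln (vol S / vol K)].
  move=> /andP[S0 SK2].
  have K0 : 0 < vol K.
    by move: (lt_le_trans S0 SK2); rewrite pmulr_lgt0 ?invr_gt0.
  have s0 : 0 < vol S / vol K by rewrite divr_gt0.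
  split => //; last by rewrite ln_div ?posrE ?expR_gt0// expRK.
  by rewrite ler_pdivrMr// mul1r; lra.
split; last split.
- move=> S SK bS SV s bound; rewrite /bound /s.
  have [s0 s1 es] := sP S SV; rewrite es; split; first exact: main.
  + move=> hs; have : 1 - n%:R <= ln (vol S / vol K).
      by rewrite -[leLHS]expRK ler_ln ?posrE ?expR_gt0.
    move=> h; rewrite min_r; first by field; rewrite !gt_eqF.
    by rewrite ler_pdivrMr// mul1r; lra.
  + move=> hs; have : ln (vol S / vol K) <= 1 - n%:R.
      by rewrite -[leRHS]expRK ler_ln ?posrE ?expR_gt0.
    move=> h; rewrite min_l ?mulr1//.
    by rewrite ler_pdivlMr// mul1r; lra.
- apply/le_ereal_inf_tmp => _ [S [SK bS SV] <-]; rewrite lee_fin.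
  have [s0 s1 _] := sP S SV.
  apply: le_trans (main S SK bS SV).
  have -> : iso_const R * r / (n%:R ^+ 2 * Rad) =
      iso_const R * r / (n%:R * Rad) * n%:R^-1.
    by field; rewrite !gt_eqF.
  apply: ler_wpM2l; first by rewrite divr_ge0 ?mulr_ge0 ?ltW.
  (* As [s <= 1] gives [1 - ln s >= 1], both entries of the minimum are at least [1 / n]. *)
  rewrite le_min invf_le1// n1' -[leLHS]mul1r ler_pM2r ?invr_gt0//.
  by rewrite lerDl oppr_ge0 ln_le0.
- by apply: xi0_le_psi0; case: bK.
Qed.
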